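(* Let $G_m$ be a bounded Vilenkin group, $0<p\le1/2$, and let $\{q_k:k\ge0\}$ be a non-decreasing sequence of non-negative numbers with $q_0>0$ satisfying $$\frac{q_{n-1}}{Q_n}=O\left(\frac1n\right)\quad\text{as }n\to\infty .$$ Then the maximal operator $$\widetilde T_p^*f:=\sup_{n\in\mathbb{N}_+}\frac{|T_nf|}{(n+1)^{1/p-2}\log^{2[1/2+p]}(n+1)}$$ is bounded from the Hardy space $H_p$ to the space $L_p$. Here $[1/2+p]$ denotes the integer part of $1/2+p$.
   Context: Let $m=(m_0,m_1,\ldots)$ be a fixed sequence of integers $m_k\ge 2$ with $\sup_k m_k<\infty$. $G_m=\prod_{k\ge0}Z_{m_k}$, $Z_{m_k}=\{0,\ldots,m_k-1\}$ the integers mod $m_k$, is the bounded Vilenkin group with product (of discrete) topology and normalized Haar measure $\mu$. $I_0(x)=G_m$, $I_n(x)=\{y\in G_m: y_0=x_0,\ldots,y_{n-1}=x_{n-1}\}$. $M_0=1$, $M_{k+1}=m_kM_k$; every $n\in\mathbb{N}$ is uniquely $n=\sum_j n_jM_j$ with $n_j\in Z_{m_j}$. $r_k(x)=\exp(2\pi i x_k/m_k)$ and $\psi_n=\prod_k r_k^{n_k}$ (Vilenkin system). $\mathbb{N}_+=\{1,2,\ldots\}$, $\mathbb{N}=\mathbb{N}_+\cup\{0\}$. For $f\in L_1(G_m)$: $\widehat f(n)=\int_{G_m} f\overline{\psi_n}\,d\mu$; $S_0f=0$, $S_nf=\sum_{k=0}^{n-1}\widehat f(k)\psi_k$. $\|g\|_p=(\int_{G_m}|g|^pd\mu)^{1/p}$.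 Let $\mathcal F_n$ be the $\sigma$-algebra generated by the sets $I_n(x)$, $x\in G_m$. A martingale is a sequence $f=(f^{(n)}:n\in\mathbb{N})$ of integrable functions with $f^{(n)}$ $\mathcal F_n$-measurable and $S_{M_n}f^{(l)}=f^{(n)}$ for $n\le l$. $f^*=\sup_n|f^{(n)}|$; $H_p$ ($0<p<\infty$) is the space of martingales with $\|f\|_{H_p}:=\|f^*\|_p<\infty$. For a martingale, $\widehat f(i)=\lim_{k\to\infty}\int_{G_m}f^{(k)}\overline{\psi_i}\,d\mu$ and $S_nf=\sum_{k=0}^{n-1}\widehat f(k)\psi_k$. $T$ means: $T_nf=\frac1{Q_n}\sum_{k=0}^{n-1}q_kS_kf$ with $Q_n=\sum_{k=0}^{n-1}q_k$. An operator $A$ is bounded from $H_p$ to $L_p$ if there is a constant $C$ with $\|Af\|_p\le C\|f\|_{H_p}$ for all $f\in H_p$. *)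

(* Defs.v *)
From HB Require Import structures.
From mathcomp Require Import all_boot all_order all_algebra.
From mathcomp Require Import all_classical all_reals all_analysis.
From mathcomp Require Import complex.

Set Implicit Arguments.
Unset Strict Implicit.
Unset Printing Implicit Defensive.

Import Order.TTheory GRing.Theory Num.Theory.
Import numFieldNormedType.Exports.

Local Open Scope classical_set_scope.
Local Open Scope ring_scope.

(* The Vilenkin group. ['Z_n] is the ring of integers mod n only for [1 < n], so
   [vilenkin m] is meaningful under the hypothesis [forall k, 1 < m k]. *)
Definition vilenkin (m : nat -> nat) : Type :=
  prod_topology (fun k => discrete_topology 'Z_(m k)).

Section vilenkin_group.
Variable m : nat -> nat.

HB.instance Definition _ := Choice.on (vilenkin m).
HB.instance Definition _ := isPointed.Build (vilenkin m) (fun k => 0 : 'Z_(m k)).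
HB.instance Definition _ := Topological.copy (vilenkin m)
  (prod_topology (fun k => discrete_topology 'Z_(m k))).

Let add (x y : vilenkin m) : vilenkin m := fun k => (x k : 'Z_(m k)) + y k.
Let opp (x : vilenkin m) : vilenkin m := fun k => - (x k : 'Z_(m k)).
Let zero : vilenkin m := fun k => 0 : 'Z_(m k).

Let addA : associative add.
Proof. by move=> x y z; apply: functional_extensionality_dep => k; exact: addrA. Qed.
Let addC : commutative add.
Proof. by move=> x y; apply: functional_extensionality_dep => k; exact: addrC. Qed.
Let add0 : left_id zero add.
Proof. by move=> x; apply: functional_extensionality_dep => k; exact: add0r. Qed.
Let addN : left_inverse zero opp add.
Proof. by move=> x; apply: functional_extensionality_dep => k; exact: addNr. Qed.

HB.instance Definition _ :=
  GRing.isZmodule.Build (vilenkin m) addA addC add0 addN.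

(* the Borel sigma-algebra of the product topology *)
HB.instance Definition _ := Measurable.copy (vilenkin m)
  (g_sigma_algebraType (@open (vilenkin m))).

End vilenkin_group.

Section vilenkin_fourier.
Context {R : realType} {m : nat -> nat}.
Implicit Types (mu : probability (vilenkin m) R) (x : vilenkin m).

(* A Borel probability measure on this compact metrizable group is
   automatically regular, so translation invariance is all that is needed. *)
Definition normalized_haar mu : Prop :=
  forall (A : set (vilenkin m)) x, measurable A ->
    mu [set x + y | y in A] = mu A.

Definition cylinder (n : nat) x : set (vilenkin m) :=
  [set y | forall k, (k < n)%N -> y k = x k].

Definition vilenkin_M (n : nat) : nat := (\prod_(k < n) m k)%N.

Definition vilenkin_digit (n k : nat) : nat :=
  ((n %/ vilenkin_M k) %% m k)%N.

(* exp (2 pi i x_k / m_k) *)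
Definition rademacher (k : nat) x : R[i] :=
  let t := 2 * pi * (x k : 'Z_(m k))%:R / (m k)%:R in (cos t +i* sin t)%C.

(* When all [m k >= 2], [n < 2 ^ n <= M_n], so the digits of [n] of index
   [k >= n] vanish. *)
Definition vilenkin_psi (n : nat) x : R[i] :=
  \prod_(k < n) rademacher k x ^+ vilenkin_digit n k.

Definition cintegral mu (f : vilenkin m -> R[i]) : R[i] :=
  ((\int[mu]_x complex.Re (f x)) +i* (\int[mu]_x complex.Im (f x)))%C.

Definition cintegrable mu (f : vilenkin m -> R[i]) : Prop :=
  mu.-integrable setT (fun x => (complex.Re (f x))%:E) /\
  mu.-integrable setT (fun x => (complex.Im (f x))%:E).

(* measurability with respect to the sigma-algebra F_n generated by the
   cylinders of rank n *)
Definition cylinder_measurable (n : nat) (f : vilenkin m -> R[i]) : Prop :=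
  let Fn := g_sigma_algebraType (range (cylinder n)) in
  measurable_fun [set: Fn] (fun x : Fn => complex.Re (f x)) /\
  measurable_fun [set: Fn] (fun x : Fn => complex.Im (f x)).

Definition fourier_coef mu (f : vilenkin m -> R[i]) (n : nat) : R[i] :=
  cintegral mu (fun x => f x * (vilenkin_psi n x)^*%C).

Definition partial_sum (c : nat -> R[i]) (n : nat) x : R[i] :=
  \sum_(k < n) c k * vilenkin_psi k x.

(* Equality everywhere and almost everywhere agree in the last clause: both
   sides are constant on cylinders of rank [n], which have positive measure. *)
Record martingale mu (f : nat -> vilenkin m -> R[i]) : Prop := Martingale {
  martingale_integrable : forall n, cintegrable mu (f n) ;
  martingale_adapted : forall n, cylinder_measurable n (f n) ;
  martingale_proj : forall n l, (n <= l)%N ->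
    partial_sum (fourier_coef mu (f l)) (vilenkin_M n) = f n }.

(* [limn] needs a topology on the value space, carried by [R[i]^o]. *)
Definition mfourier_coef mu (f : nat -> vilenkin m -> R[i]) (i : nat) : R[i] :=
  limn (fun k => fourier_coef mu (f k) i : R[i]^o).

Definition mpartial_sum mu (f : nat -> vilenkin m -> R[i]) :
    nat -> vilenkin m -> R[i] :=
  partial_sum (mfourier_coef mu f).

Definition martingale_max (f : nat -> vilenkin m -> R[i]) x : \bar R :=
  ereal_sup [set (Normc.normc (f n x))%:E | n in [set: nat]].

Definition hardy_norm mu (p : R) (f : nat -> vilenkin m -> R[i]) : \bar R :=
  ('N[mu]_(p%:E)[martingale_max f])%E.

Definition hardy_space mu (p : R) : set (nat -> vilenkin m -> R[i]) :=
  [set f | martingale mu f /\ (hardy_norm mu p f < +oo)%E].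

Definition bounded_hardy_Lp mu (p : R)
    (A : (nat -> vilenkin m -> R[i]) -> vilenkin m -> \bar R) : Prop :=
  exists C : R, forall f, hardy_space mu p f ->
    ('N[mu]_(p%:E)[A f] <= C%:E * hardy_norm mu p f)%E.

Definition weight_sum (q : nat -> R) (n : nat) : R := \sum_(k < n) q k.

Definition T_mean mu (q : nat -> R) (n : nat)
    (f : nat -> vilenkin m -> R[i]) x : R[i] :=
  ((weight_sum q n)^-1)%:C%C * \sum_(k < n) (q k)%:C%C * mpartial_sum mu f k x.

Definition T_max mu (q : nat -> R) (p : R)
    (f : nat -> vilenkin m -> R[i]) x : \bar R :=
  ereal_sup [set (Normc.normc (T_mean mu q n f x) /
                  (n.+1%:R `^ (p^-1 - 2) *
                   ln n.+1%:R ^ (2 * Num.floor (2^-1 + p))))%:E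
            | n in [set n | (0 < n)%N]].

End vilenkin_fourier.

(* Main.v *)
Require Import Defs.
From HB Require Import structures.
From mathcomp Require Import all_boot all_order all_algebra.
From mathcomp Require Import all_classical all_reals all_analysis.
From mathcomp Require Import complex measurable_realfun.
From mathcomp Require Import ring lra.

Set Implicit Arguments.
Unset Strict Implicit.
Unset Printing Implicit Defensive.

Import Order.TTheory GRing.Theory Num.Theory.
Import numFieldNormedType.Exports.

Local Open Scope classical_set_scope.
Local Open Scope ring_scope.

(** For [n <= M_N], [T_n f] only depends on the [N]-th term of the martingale and
    is a convolution with the kernel [Q_n^-1 sum_(k < n) q_k D_k].  By Abel
    summation the growth condition bounds this kernel by [C / n] times any
    common bound of the Fejer sums [L_j = sum_(k < j) D_k], [j <= n], and the
    recursion of [L] along [n = j M_l + n'] bounds all of them for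
    [n <= M_(l+1)] by an explicit nonnegative function, the majorant.

    A martingale is cut at the heights [2^k c] by predictable stopping times, as
    in the atomic decomposition of [H_p]: the piece of height [2^k c] starting
    at time [K] has conditional expectation zero given the first [K]
    coordinates, so [T_n] kills it for [n <= M_K]; for [n > M_K] the majorant
    may be averaged over the coordinates beyond [K] at the price of a factor
    [n / M_K].  As [p <= 1], [p]-th powers of sums are at most sums of [p]-th
    powers, and integrating leaves [sum_(l <= K) M_l^(2p-1)], which is bounded
    for [p < 1/2] and of order [K] (hence the logarithms) for [p = 1/2].  All
    this happens for functions of finitely many coordinates; Fatou's lemma
    removes the restriction [n <= M_N]. *)

(** * Functions of finitely many coordinates and their averages *)

(** The exponents come from a single estimate. If [|g| <= a 1_S] with [S] depending on the first [K]
    coordinates, then for [n >= M_K] the convolution is at most [C a / M_K] times the integral over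
    [t] in [S] of [majorant K (x - t)]. This integrand is constant on cylinders of rank [K], so
    moving the [p]-th power inside costs only [M_K^(1-p)] and leaves [a^p |S| M_K^(1-2p)] times the
    integral of [majorant K] to the power [p]. The weight at [n = M_K], raised to the power [p],
    absorbs [M_K^(1-2p)] when [p < 1/2], and the [K + 1] unit terms of the last integral when
    [p = 1/2]. Hence [S] may be any set of rank [K], and no separate estimates on and off the
    support of a piece are made.

    Stopping after the height has been passed would overshoot it by an uncontrolled jump. Stopping
    one step earlier, as soon as some child of the current cylinder passes the height, removes the
    overshoot; since [m] is bounded, this enlarges the stopped set by a bounded factor only. *)

Section coordinates.
Variable m : nat -> nat.
Local Notation V := (vilenkin m).
Implicit Types (x y : V) (k n N : nat).

Definition crd x k : 'Z_(m k) := x k.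

Definition agree n x y := forall k, (k < n)%N -> crd x k = crd y k.

(** Measurability with respect to the cylinders of rank [n], in a pointwise form that mentions no
    measure; integrals of such functions are finite averages. *)
Definition level (T : Type) n (g : V -> T) :=
  forall x y, agree n x y -> g x = g y.

Definition delta (k : nat) (a : 'Z_(m k)) : V :=
  @eqtype.dfwith _ (fun i => 'Z_(m i)) (fun i => 0) k a.

Lemma vilenkin_ext x y : (forall k, crd x k = crd y k) -> x = y.
Proof. by move=> xy; apply: functional_extensionality_dep. Qed.

Lemma crdD x y k : crd (x + y) k = crd x k + crd y k. Proof. by []. Qed.
Lemma crdN x k : crd (- x) k = - crd x k. Proof. by []. Qed.
Lemma crd0 k : crd 0 k = 0. Proof. by []. Qed.

Lemma crd_delta k (a : 'Z_(m k)) : crd (delta a) k = a.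
Proof. exact: eqtype.dfwith_in. Qed.

Lemma crd_delta_neq k (a : 'Z_(m k)) i : i != k -> crd (delta a) i = 0.
Proof. by move=> ik; apply: eqtype.dfwith_out; rewrite eq_sym. Qed.

Lemma deltaN k (a : 'Z_(m k)) : delta (- a) = - delta a.
Proof.
apply: vilenkin_ext => i; rewrite crdN; have [->|ik] := eqVneq i k.
  by rewrite !crd_delta.
by rewrite !crd_delta_neq // oppr0.
Qed.

Lemma agree_sym n x y : agree n x y -> agree n y x.
Proof. by move=> xy k kn; rewrite xy. Qed.

Lemma agree_trans n x y z : agree n x y -> agree n y z -> agree n x z.
Proof. by move=> xy yz k kn; rewrite xy // yz. Qed.

Lemma agreeW n n' x y : (n <= n')%N -> agree n' x y -> agree n x y.
Proof. by move=> nn' xy k kn; apply: xy; apply: leq_trans nn'. Qed.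

Lemma agree_delta n k (a : 'Z_(m k)) x : (n <= k)%N -> agree n (x + delta a) x.
Proof.
move=> nk i ilt; rewrite crdD crd_delta_neq ?addr0 // ltn_eqF //.
exact: leq_trans nk.
Qed.

Lemma agreeD n x y z : agree n x y -> agree n (x + z) (y + z).
Proof. by move=> xy k kn; rewrite !crdD xy. Qed.

Lemma agreeS n x y : agree n x y ->
  agree n.+1 (x + delta (crd y n - crd x n)) y.
Proof.
move=> xy k; rewrite ltnS leq_eqVlt => /orP[/eqP ->|kn].
  by rewrite crdD crd_delta addrC subrK.
by rewrite crdD crd_delta_neq ?ltn_eqF // addr0 xy.
Qed.

Lemma levelW (T : Type) n n' (g : V -> T) : (n <= n')%N -> level n g -> level n' g.
Proof. by move=> nn' gn x y xy; apply: gn; apply: agreeW xy. Qed.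

Lemma level_delta (T : Type) n (g : V -> T) : level n g ->
  forall k (a : 'Z_(m k)) x, (n <= k)%N -> g (x + delta a) = g x.
Proof. by move=> gn k a x nk; apply: gn; apply: agree_delta. Qed.

Lemma level_comp (T U : Type) n (g : V -> T) (h : T -> U) :
  level n g -> level n (fun x => h (g x)).
Proof. by move=> gn x y xy; rewrite (gn x y). Qed.

Lemma level_comp2 (T U W : Type) n (g : V -> T) (g' : V -> U) (h : T -> U -> W) :
  level n g -> level n g' -> level n (fun x => h (g x) (g' x)).
Proof. by move=> gn g'n x y xy; rewrite (gn x y) // (g'n x y). Qed.

Lemma level_sum (F : nmodType) n (I : Type) (r : seq I) (P : pred I)
    (g : I -> V -> F) : (forall i, P i -> level n (g i)) ->
  level n (fun x => \sum_(i <- r | P i) g i x).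
Proof. by move=> gn x y xy; apply: eq_bigr => i Pi; exact: gn. Qed.

Lemma level0 (T : Type) (g : V -> T) : level 0 g -> forall x y, g x = g y.
Proof. by move=> g0 x y; apply: g0. Qed.

End coordinates.

Section averages.
Variable m : nat -> nat.
Hypothesis m_ge2 : forall k, (2 <= m k)%N.
Local Notation V := (vilenkin m).
Implicit Types (x y : V) (k n N : nat) (s : seq nat).

Lemma card_crd k : #|'Z_(m k)| = m k.
Proof. by rewrite card_ord Zp_cast. Qed.

Section generic.
Variable F : numFieldType.
Implicit Types (g h : V -> F).

(** The translates by [delta a] run once through all values of coordinate [k], so this is the
    conditional expectation that forgets that coordinate. *)
Definition coord_avg k g : V -> F :=
  fun x => (m k)%:R^-1 * \sum_(a : 'Z_(m k)) g (x + delta a).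

Definition avg s g : V -> F := foldr coord_avg g s.

Lemma mR_neq0 k : (m k)%:R != 0 :> F.
Proof. by rewrite pnatr_eq0 -lt0n (leq_trans _ (m_ge2 k)). Qed.

Lemma mR_gt0 k : 0 < (m k)%:R :> F.
Proof. by rewrite ltr0n (leq_trans _ (m_ge2 k)). Qed.

Lemma avg_cat s s' g : avg (s ++ s') g = avg s (avg s' g).
Proof. by rewrite /avg foldr_cat. Qed.

Lemma coord_avgM k g h : (forall x (a : 'Z_(m k)), h (x + delta a) = h x) ->
  coord_avg k (fun x => g x * h x) = fun x => coord_avg k g x * h x.
Proof.
move=> hk; apply/funext => x; rewrite /coord_avg -mulrA; congr (_ * _).
by rewrite mulr_suml; apply: eq_bigr => a _; rewrite hk.
Qed.

Lemma avgM s g h :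
  (forall k, k \in s -> forall x (a : 'Z_(m k)), h (x + delta a) = h x) ->
  avg s (fun x => g x * h x) = fun x => avg s g x * h x.
Proof.
elim: s => //= k s IH hs; rewrite IH => [|k' k's]; last first.
  by apply: hs; rewrite inE k's orbT.
by rewrite coord_avgM // => x a; apply: hs; rewrite inE eqxx.
Qed.

Lemma avgM_level n d e g h : level n h -> (n <= d)%N ->
  avg (iota d e) (fun x => g x * h x) = fun x => avg (iota d e) g x * h x.
Proof.
move=> hn nd; apply: avgM => k; rewrite mem_iota => /andP[dk _] x a.
by apply: level_delta hn _ _ _ _; apply: leq_trans dk.
Qed.

Lemma avgMr s g c : avg s (fun x => g x * c) = fun x => avg s g x * c.
Proof. exact: avgM. Qed.

Lemma avgMl s g c : avg s (fun x => c * g x) = fun x => c * avg s g x.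
Proof.
under [in LHS]eq_fun do rewrite mulrC.
by rewrite avgMr; apply/funext => x; rewrite mulrC.
Qed.

Lemma avg_cst s c : avg s (fun=> c) = fun=> c.
Proof.
elim: s => //= k s ->; apply/funext => x; rewrite /coord_avg.
by rewrite sumr_const card_crd -[c *+ _]mulr_natl mulrA mulVf ?mul1r // mR_neq0.
Qed.

Lemma avg_sum (I : Type) (r : seq I) (P : pred I) (G : I -> V -> F) s :
  avg s (fun x => \sum_(i <- r | P i) G i x) =
  fun x => \sum_(i <- r | P i) avg s (G i) x.
Proof.
elim: s => //= k s ->; apply/funext => x; rewrite /coord_avg.
by rewrite exchange_big /= mulr_sumr; apply: eq_bigr.
Qed.

Lemma avgD s g h : avg s (fun x => g x + h x) = fun x => avg s g x + avg s h x.
Proof.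
elim: s => //= k s ->; apply/funext => x; rewrite /coord_avg.
by rewrite big_split mulrDr.
Qed.

Lemma avgN s g : avg s (fun x => - g x) = fun x => - avg s g x.
Proof.
under [in LHS]eq_fun do rewrite -mulN1r.
by rewrite avgMl; apply/funext => x; rewrite mulN1r.
Qed.

Lemma avgB s g h : avg s (fun x => g x - h x) = fun x => avg s g x - avg s h x.
Proof. by rewrite avgD avgN. Qed.

Lemma avg_level_id n d e g : level n g -> (n <= d)%N -> avg (iota d e) g = g.
Proof.
move=> gn nd; have /funext := fun x => mul1r (g x); move=> {1}<-.
rewrite (@avgM_level n d e (fun=> 1) g) // avg_cst.
by apply/funext => x; rewrite mul1r.
Qed.

(** Points that agree below [n] have the same translates in coordinate [n] up to [agree n.+1], only
    listed in another order. *)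
Lemma coord_avg_levelS n g : level n.+1 g -> level n (coord_avg n g).
Proof.
move=> gn x y xy; rewrite /coord_avg; congr (_ * _).
rewrite (reindex_inj (addrI (crd y n - crd x n))) /=.
apply: eq_bigr => a _; apply: gn => k.
rewrite ltnS leq_eqVlt => /orP[/eqP ->|kn].
  by rewrite !crdD !crd_delta addrA [crd x n + _]addrC subrK.
by rewrite !crdD !crd_delta_neq ?ltn_eqF // !addr0 xy.
Qed.

Lemma avg_iota_level n d g : level (n + d) g -> level n (avg (iota n d) g).
Proof.
elim: d n => [|d IH] n; first by rewrite addn0.
by move=> gn /=; apply: coord_avg_levelS; apply: IH; rewrite addSnnS.
Qed.

Lemma avg_shift s g y : avg s (fun t => g (y + t)) = fun x => avg s g (y + x).
Proof.
elim: s => //= k s ->; apply/funext => x; rewrite /coord_avg; congr (_ * _).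
by apply: eq_bigr => a _; rewrite addrA.
Qed.

Lemma avg_opp s g : avg s (fun t => g (- t)) = fun x => avg s g (- x).
Proof.
elim: s => //= k s ->; apply/funext => x; rewrite /coord_avg; congr (_ * _).
rewrite (reindex_inj oppr_inj) /=; apply: eq_bigr => a _.
by rewrite deltaN opprD opprK.
Qed.

Lemma avg_reflect s g y : avg s (fun t => g (y - t)) = fun x => avg s g (y - x).
Proof.
by rewrite (avg_opp s (fun t => g (y + t))) (avg_shift s g).
Qed.

Lemma avg_exchange s s' (G : V -> V -> F) x0 t0 :
  avg s (fun x => avg s' (fun t => G x t) t0) x0 =
  avg s' (fun t => avg s (fun x => G x t) x0) t0.
Proof.
elim: s' t0 => //= k s' IH t0.
rewrite /coord_avg avgMl; congr (_ * _).
by rewrite avg_sum; apply: eq_bigr => a _; exact: IH.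
Qed.

(* For [level N] functions, [mean N] is the Haar integral and
   [avg (iota n (N - n))] the conditional expectation given the first [n]
   coordinates. *)
Definition mean N g : F := avg (iota 0 N) g 0.

Lemma mean_level N g x : level N g -> avg (iota 0 N) g x = mean N g.
Proof. by move=> gN; apply: (level0 (avg_iota_level (n := 0) gN)). Qed.

Lemma iota_split (K N : nat) : (K <= N)%N -> iota 0 N = iota 0 K ++ iota K (N - K).
Proof. by move=> KN; rewrite -[X in iota 0 X](subnKC KN) iotaD. Qed.

Lemma mean_split K N g : (K <= N)%N -> mean N g = mean K (avg (iota K (N - K)) g).
Proof. by move=> KN; rewrite /mean (iota_split KN) avg_cat. Qed.

Lemma mean_levelE K N g : (K <= N)%N -> level K g -> mean N g = mean K g.
Proof. by move=> KN gK; rewrite (mean_split _ KN) (avg_level_id _ gK). Qed.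

Lemma mean_reflect N g x : level N g -> mean N (fun t => g (x - t)) = mean N g.
Proof. by move=> gN; rewrite /mean avg_reflect subr0 mean_level. Qed.

Lemma mean_shift N g z : level N g -> mean N (fun t => g (t + z)) = mean N g.
Proof.
move=> gN; rewrite -[RHS](mean_level z gN) /mean.
under [in LHS]eq_fun do rewrite addrC.
by rewrite avg_shift addr0.
Qed.

(* [g] does not see the coordinates [K, ..., N - 1], so that averaging over
   them only affects the kernel. *)
Lemma mean_convol K N g h x : (K <= N)%N -> level N h -> level K g ->
  mean N (fun t => g t * h (x - t)) =
  mean N (fun t => g t * avg (iota K (N - K)) h (x - t)).
Proof.
move=> KN hN gK; rewrite !(mean_split _ KN); congr (mean K _); apply/funext => y.
under [in LHS]eq_fun do rewrite mulrC.
under [in RHS]eq_fun do rewrite mulrC.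
rewrite !(avgM_level _ _ gK) //; congr (_ * _).
rewrite !avg_reflect -[in RHS]avg_cat.
have hK : level K (avg (iota K (N - K)) h).
  by apply: avg_iota_level; rewrite subnKC.
by rewrite avg_cat [in RHS](avg_level_id _ hK).
Qed.

End generic.
End averages.

(** * Inequalities for averages and for [p]-th powers *)

Section real_averages.
Variables (R : realType) (m : nat -> nat).
Hypothesis m_ge2 : forall k, (2 <= m k)%N.
Local Notation V := (vilenkin m).
Local Notation M := (@vilenkin_M m).
Implicit Types (x y : V) (g h : V -> R).

Lemma vilenkin_MS n : M n.+1 = (M n * m n)%N.
Proof. by rewrite /vilenkin_M big_ord_recr. Qed.

Lemma vilenkin_M0 : M 0 = 1%N.
Proof. by rewrite /vilenkin_M big_ord0. Qed.

Lemma vilenkin_M_gt0 n : (0 < M n)%N.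
Proof.
apply: prodn_gt0 => k; exact: (leq_trans _ (m_ge2 k)).
Qed.

Lemma vilenkin_M_double n : (2 * M n <= M n.+1)%N.
Proof. by rewrite vilenkin_MS [leqRHS]mulnC leq_mul2r m_ge2 orbT. Qed.

Lemma leq_vilenkin_M n n' : (n <= n')%N -> (M n <= M n')%N.
Proof.
move=> /subnKC <-; elim: (n' - n)%N => [|d IH]; first by rewrite addn0.
apply: (leq_trans IH); rewrite addnS; apply: leq_trans (vilenkin_M_double _).
by rewrite leq_pmull.
Qed.

Lemma leq_exp2_vilenkin_M n : (2 ^ n <= M n)%N.
Proof.
elim: n => [|n IH]; first by rewrite vilenkin_M0.
by rewrite expnS; apply: leq_trans (vilenkin_M_double n); rewrite leq_mul2l IH orbT.
Qed.

Lemma ltn_vilenkin_M n : (n < M n)%N.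
Proof. by apply: leq_trans (leq_exp2_vilenkin_M n); exact: ltn_expl. Qed.

Lemma vilenkin_MR_gt0 n : 0 < (M n)%:R :> R.
Proof. by rewrite ltr0n vilenkin_M_gt0. Qed.

Lemma vilenkin_MR_neq0 n : (M n)%:R != 0 :> R.
Proof. by rewrite gt_eqF // vilenkin_MR_gt0. Qed.

Lemma ler_avg s g h : (forall x, g x <= h x) -> forall x, avg s g x <= avg s h x.
Proof.
move=> gh; elim: s => //= k s IH x; rewrite /coord_avg ler_wpM2l ?invr_ge0 //.
by apply: ler_sum => a _.
Qed.

Lemma avg_ge0 s g : (forall x, 0 <= g x) -> forall x, 0 <= avg s g x.
Proof. by move=> /(@ler_avg s) g0 x; have := g0 x; rewrite avg_cst. Qed.

Lemma ler_mean N g h : (forall x, g x <= h x) -> mean N g <= mean N h.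
Proof. by move=> gh; apply: ler_avg. Qed.

Lemma mean_ge0 N g : (forall x, 0 <= g x) -> 0 <= mean N g.
Proof. by move=> g0; apply: avg_ge0. Qed.

(** Each average over a coordinate [n] retains the term [a = 0] with proportion [1 / m n]; the
    product of these losses is [M N]. *)
Lemma ler_level_mean N g : level N g -> (forall x, 0 <= g x) ->
  forall x, g x <= (M N)%:R * mean N g.
Proof.
move=> gN g0 x; rewrite -(mean_level x gN) {gN}.
elim: N x => [|n IH] x; first by rewrite /avg /= vilenkin_M0 mul1r.
rewrite -addn1 iotaD avg_cat addn1 add0n.
apply: (le_trans (IH x)); rewrite vilenkin_MS natrM -mulrA.
rewrite ler_wpM2l //.
have -> (h : V -> R) : (m n)%:R * avg (iota 0 n) h x =
  avg (iota 0 n) (fun y => (m n)%:R * h y) x by rewrite avgMl.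
apply: ler_avg => y /=; rewrite /coord_avg mulVKf ?mR_neq0 //.
rewrite (bigD1 0) //=.
have -> : y + delta (0 : 'Z_(m n)) = y.
  apply: vilenkin_ext => k; rewrite crdD; have [->|kn] := eqVneq k n.
    by rewrite crd_delta addr0.
  by rewrite crd_delta_neq // addr0.
by rewrite lerDl sumr_ge0.
Qed.

Lemma lt1_powR2 (p : R) : 0 < p -> 1 < 2 `^ p.
Proof.
move=> p0; rewrite -[X in X < _](congr1 (@^~ p) (powR1 R)).
by rewrite gt0_ltr_powR ?nnegrE ?ltr1n.
Qed.

(** Divided by [a + b], both summands lie in [[0, 1]], where [t <= t^p]. *)
Lemma powR_add_le (p a b : R) : 0 <= a -> 0 <= b -> 0 < p <= 1 ->
  (a + b) `^ p <= a `^ p + b `^ p.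
Proof.
move=> a0 b0 /andP[p0 p1].
have [ab0|abn] := eqVneq (a + b) 0.
  by rewrite ab0 powR0 ?gt_eqF // addr_ge0 ?powR_ge0.
have ab : 0 < a + b by rewrite lt_neqAle eq_sym abn addr_ge0.
have frac c : 0 <= c <= a + b -> c / (a + b) <= (c / (a + b)) `^ p.
  move=> /andP[c0 cab]; set t := c / _.
  have t0 : 0 <= t by rewrite divr_ge0 // ltW.
  have t1 : t <= 1 by rewrite ler_pdivrMr // mul1r.
  have [->|tn] := eqVneq t 0; first exact: powR_ge0.
  by rewrite -[leLHS]powRr1 // ger_powR // lt_neqAle eq_sym tn t0.
have fracE c : 0 <= c -> (c / (a + b)) `^ p * (a + b) `^ p = c `^ p.
  move=> c0; rewrite -powRM ?divfK ?divr_ge0 //; exact: ltW.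
rewrite -(fracE a) // -(fracE b) // -mulrDl.
rewrite -[leLHS]mul1r ler_wpM2r ?powR_ge0 //.
have <- : a / (a + b) + b / (a + b) = 1 by rewrite -mulrDl divff.
by apply: lerD; apply: frac; rewrite ?a0 ?b0 ?lerDl ?lerDr.
Qed.

Lemma powR_sum_le (I : Type) (r : seq I) (P : pred I) (F : I -> R) (p : R) :
  0 < p <= 1 -> (forall i, P i -> 0 <= F i) ->
  (\sum_(i <- r | P i) F i) `^ p <= \sum_(i <- r | P i) F i `^ p.
Proof.
move=> p01 F0.
suff [] : 0 <= \sum_(i <- r | P i) F i /\
  (\sum_(i <- r | P i) F i) `^ p <= \sum_(i <- r | P i) F i `^ p by [].
elim/big_rec2 : _ => [|i y z Pi [z0 zy]].
  by rewrite powR0 // gt_eqF //; case/andP: p01.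
split; first by rewrite addr_ge0 // F0.
by apply: (le_trans (powR_add_le _ _ p01)); rewrite ?F0 // lerD2l.
Qed.

(** Jensen's inequality goes the other way for [p <= 1]. Subadditivity of the power replaces it: an
    average of [m n] terms costs the factor [m_n * m_n^(-p)], and the product of these is
    [M_N^(1-p)]. *)
Lemma mean_powR_le N g (p : R) : 0 < p <= 1 -> (forall x, 0 <= g x) ->
  mean N g `^ p <= (M N)%:R `^ (1 - p) * mean N (fun x => g x `^ p).
Proof.
move=> p01 g0; rewrite /mean; move: 0 => x; elim: N g g0 => [|n IH] g g0.
  by rewrite /avg /= vilenkin_M0 powR1 mul1r.
rewrite -addn1 iotaD !avg_cat addn1 add0n /=.
apply: (le_trans (IH _ _)) => [y|].
  by apply: (@avg_ge0 [:: n]).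
rewrite vilenkin_MS natrM powRM ?ler0n // -mulrA ler_wpM2l ?powR_ge0 //.
have -> (h : V -> R) : (m n)%:R `^ (1 - p) * avg (iota 0 n) h x =
  avg (iota 0 n) (fun y => (m n)%:R `^ (1 - p) * h y) x by rewrite avgMl.
apply: ler_avg => y; rewrite /coord_avg.
have mn0 : 0 < (m n)%:R :> R by rewrite ltr0n (leq_trans _ (m_ge2 n)).
have -> : (m n)%:R `^ (1 - p) = (m n)%:R * (m n)%:R `^ (- p) :> R.
  rewrite powRD; first by rewrite powRr1 ?ltW.
  by apply/implyP => _; rewrite gt_eqF.
rewrite [leRHS]mulrACA mulfV ?gt_eqF // mul1r.
rewrite powRM ?invr_ge0 ?sumr_ge0 ?ler0n // -powR_inv1 ?ler0n // -powRrM mulN1r.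
by rewrite ler_wpM2l ?powR_ge0 // powR_sum_le.
Qed.

End real_averages.

(** * The majorant of the Fejer sums *)

Section kernel_majorant.
Variables (R : realType) (m : nat -> nat).
Hypothesis m_ge2 : forall k, (2 <= m k)%N.
Local Notation V := (vilenkin m).
Local Notation MR n := ((@vilenkin_M m n)%:R : R).
Implicit Types (x y : V) (s l n K N : nat).

(** All coordinates below [l] vanish, except that coordinate [s] is free; for [s >= l] this is the
    cylinder of rank [l] at zero. Sets of this shape carry the Fejer sum of order [M l]. *)
Fixpoint spike s l x : bool :=
  if l is l'.+1 then spike s l' x && ((l' == s) || (crd x l' == 0)) else true.

Definition spikeR s l x : R := (spike s l x)%:R.

Lemma spike_level s l : level l (spike s l).
Proof.
elim: l => // l IH x y xy /=; rewrite (IH x y) ?xy //.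
exact: agreeW xy.
Qed.

Lemma spikeR_level s l : level l (spikeR s l).
Proof. by move=> x y xy; rewrite /spikeR (@spike_level s l _ _ xy). Qed.

Lemma spikeR_ge0 s l x : 0 <= spikeR s l x. Proof. exact: ler0n. Qed.

Lemma spikeE s l :
  spike s l = fun x => [forall k : 'I_l, (k == s :> nat) || (crd x k == 0)].
Proof.
apply/funext => x; elim: l => [|l IH] /=.
  by apply/esym/forallP => -[].
rewrite IH; apply/andP/forallP => [[/forallP h hl] k|h].
  have [kl|] := ltnP k l; first exact: (h (Ordinal kl)).
  by move=> lk; have -> : k = ord_max by apply/val_inj/anti_leq; rewrite lk -ltnS ltn_ord.
split; last exact: (h ord_max).
by apply/forallP => k; apply: (h (widen_ord (leqnSn l) k)).
Qed.

Lemma spike_out s l : (l <= s)%N -> spike s l = spike l l.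
Proof.
move=> ls; rewrite !spikeE; apply/funext => x; apply: eq_forallb => k.
by rewrite !ltn_eqF // (leq_trans _ ls).
Qed.

Lemma spikeR_out s l : (l <= s)%N -> spikeR s l = spikeR l l.
Proof. by move=> ls; rewrite /spikeR spike_out. Qed.

(** Forgetting a coordinate that was forced to vanish costs [1 / m l]; forgetting the free one costs
    nothing. *)
Lemma coord_avg_spikeR s l : coord_avg l (spikeR s l.+1) =
  fun x => (if s == l then spikeR l l x else (m l)%:R^-1 * spikeR s l x).
Proof.
apply/funext => x; rewrite /coord_avg.
have spl a : spikeR s l.+1 (x + delta a) =
    spikeR s l x * ((l == s) || (a == - crd x l))%:R.
  rewrite /spikeR -natrM mulnb /= (level_delta (@spike_level s l)) // crdD.
  by rewrite crd_delta addrC addr_eq0.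
rewrite (eq_bigr _ (fun a _ => spl a)) -mulr_sumr eq_sym.
case: eqVneq => [->|sl] /=.
  rewrite sumr_const card_crd // mulrC -mulrA divff ?mulr1 //.
  by rewrite mR_neq0.
rewrite (bigD1 (- crd x l)) //= eqxx big1 ?addr0 ?mulr1 // => a.
by move=> /negPf ->.
Qed.

(** The classical shape of [M l] times the Fejer kernel of order [M l]. *)
Definition majorant_off l x : R := MR l * \sum_(s < l) MR s * spikeR s l x.

(** The term with [MR l ^+ 2] accounts for the Dirichlet kernels of order [j * M l], which live on
    the cylinder of rank [l] and enter [fejer_sum] with multiplicity up to [M l]. *)
Definition majorant_term l x : R :=
  majorant_off l x + MR l ^+ 2 * spikeR l l x.

Definition majorant l x : R := \sum_(j < l.+1) majorant_term j x.

Lemma majorant_off_level l : level l (majorant_off l).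
Proof.
move=> x y xy; rewrite /majorant_off; congr (_ * _); apply: eq_bigr => s _.
by rewrite (@spikeR_level s l _ _ xy).
Qed.

Lemma majorant_term_level l : level l (majorant_term l).
Proof.
by move=> x y xy; rewrite /majorant_term (@majorant_off_level l _ _ xy)
  (@spikeR_level l l _ _ xy).
Qed.

Lemma majorant_level l : level l (majorant l).
Proof.
apply: level_sum => j _; apply: (@levelW m _ j); last exact: majorant_term_level.
by rewrite -ltnS.
Qed.

Lemma majorant_off_ge0 l x : 0 <= majorant_off l x.
Proof. by rewrite mulr_ge0 // sumr_ge0 // => s _; rewrite mulr_ge0 ?spikeR_ge0. Qed.

Lemma majorant_term_ge0 l x : 0 <= majorant_term l x.
Proof. by rewrite addr_ge0 ?majorant_off_ge0 // mulr_ge0 ?spikeR_ge0 ?exprn_ge0. Qed.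

Lemma majorant_ge0 l x : 0 <= majorant l x.
Proof. by apply: sumr_ge0 => j _; exact: majorant_term_ge0. Qed.

Lemma coord_avg_majorant_off l : coord_avg l (majorant_off l.+1) =
  fun x => majorant_off l x + MR l.+1 * (MR l * spikeR l l x).
Proof.
apply/funext => x; rewrite /majorant_off.
rewrite -[coord_avg l _]/(avg [:: l] _) avgMl avg_sum.
under eq_bigr do rewrite avgMl.
rewrite big_ord_recr mulrDr /= coord_avg_spikeR eqxx; congr (_ + _).
rewrite !mulr_sumr; apply: eq_bigr => s _; rewrite coord_avg_spikeR.
rewrite ltn_eqF // vilenkin_MS natrM.
have := mR_neq0 m_ge2 R l; set a := (m l)%:R => a0; field; exact: a0.
Qed.

(** The functions [MR n * spikeR n n] form a martingale: they are the Dirichlet kernels of order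
    [M n]. *)
Lemma avg_majorant_spike K d x :
  avg (iota K d) (spikeR (K + d) (K + d)) x * MR (K + d) = MR K * spikeR K K x.
Proof.
elim: d x => [|d IH] x; first by rewrite addn0 mulrC.
rewrite -[d.+1]addn1 iotaD avg_cat addn1 addnS /= coord_avg_spikeR gtn_eqF //.
rewrite spikeR_out // avgMl -IH vilenkin_MS natrM.
have := mR_neq0 m_ge2 R (K + d); set a := (m (K + d))%:R => a0; field; exact: a0.
Qed.

(** Averaging over coordinate [l] creates one new term, from the spike with free coordinate [l]. Its
    factor [M_(l+1)] is at most [2 (M_(l+1) - M_l)], which telescopes. *)
Lemma avg_majorant_off K d x :
  avg (iota K d) (majorant_off (K + d)) x <=
  majorant_off K x + 2 * (MR (K + d) - MR K) * (MR K * spikeR K K x).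
Proof.
elim: d x => [|d IH] x.
  by rewrite addn0 /avg /= subrr mulr0 mul0r addr0.
rewrite -[d.+1]addn1 iotaD avg_cat addn1 addnS /= coord_avg_majorant_off.
rewrite avgD; apply: (le_trans (lerD (IH x) (lexx _))).
rewrite !avgMl [MR (K + d) * avg _ _ _]mulrC avg_majorant_spike.
rewrite -addrA lerD2l -mulrDl.
rewrite ler_wpM2r ?mulr_ge0 ?spikeR_ge0 //.
have : 2 * MR (K + d) <= MR (K + d).+1.
  by rewrite -natrM ler_nat vilenkin_M_double.
lra.
Qed.

(** Of the constant 3, two come from [avg_majorant_off] and one from the square term. *)
Lemma avg_majorant_term K d x :
  avg (iota K d) (majorant_term (K + d)) x <=
  3 * (MR (K + d) / MR K) * majorant_term K x.
Proof.
rewrite avgD (avgMl _ (spikeR _ _)) expr2 -[_ * _ * avg _ _ _]mulrA.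
rewrite [MR (K + d) * avg _ _ _]mulrC.
rewrite avg_majorant_spike.
apply: (le_trans (lerD (avg_majorant_off K d x) (lexx _))).
have MKd : MR K <= MR (K + d) by rewrite ler_nat leq_vilenkin_M // leq_addr.
have MK0 : 0 < MR K := vilenkin_MR_gt0 R m_ge2 K.
rewrite /majorant_term [leRHS]mulrDr; set o := majorant_off K x; set e := spikeR K K x.
have o0 : 0 <= o := majorant_off_ge0 K x.
have e0 : 0 <= e := spikeR_ge0 K K x.
set a := MR (K + d) in MKd *; set b := MR K in MKd MK0 *.
have -> : 3 * (a / b) * (b ^+ 2 * e) = 3 * a * (b * e).
  by field; rewrite gt_eqF.
have ob : o <= 3 * (a / b) * o.
  rewrite -[leLHS]mul1r ler_wpM2r // -[leLHS]mulr1 ler_pM // ?ler1n //.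
  by rewrite ler_pdivlMr // mul1r.
have be : 0 <= b * e by rewrite mulr_ge0 // ltW.
have : b * (b * e) >= 0 by rewrite mulr_ge0 // ltW.
lra.
Qed.

(** A sequence that grows at least geometrically is controlled by its last term: [rho / (rho - 1)]
    is the sum of the series [1 + 1/rho + ...]. *)
Lemma sum_geometric_le (rho : R) (a : nat -> R) n : 1 < rho ->
  (forall k, rho * a k <= a k.+1) -> 0 <= a 0 ->
  \sum_(k < n.+1) a k <= rho / (rho - 1) * a n.
Proof.
move=> rho1 ha a0; rewrite mulrAC ler_pdivlMr ?subr_gt0 //.
elim: n => [|n IH]; first by rewrite big_ord1; lra.
rewrite big_ord_recr /=; have := ha n; nra.
Qed.

(** Terms of index at most [K] are not affected and account for 1. A later term [j] costs
    [3 M_j / M_K]; as [M] at least doubles, these add up to at most [6 M_l / M_K]. *)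
Lemma avg_majorant K l N x : (K <= l <= N)%N ->
  avg (iota K (N - K)) (majorant l) x <= 7 * (MR l / MR K) * majorant K x.
Proof.
move=> /andP[Kl lN]; rewrite -(subnK lN) -addnBA // addnC iotaD avg_cat.
rewrite subnKC // (avg_level_id m_ge2 _ (@majorant_level l)) //.
rewrite -(subnKC Kl) addKn; move: (l - K)%N => d {N l Kl lN}.
have MK0 : 0 < MR K := vilenkin_MR_gt0 R m_ge2 K.
have -> : majorant (K + d) = fun y => majorant K y +
    \sum_(i < d) majorant_term (K + i.+1) y.
  apply/funext => y; rewrite /majorant -addSn big_split_ord /=; congr (_ + _).
  by apply: eq_bigr => i _; rewrite addSnnS.
rewrite avgD (avg_level_id m_ge2 _ (@majorant_level K)) // avg_sum.
have termK : majorant_term K x <= majorant K x.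
  by rewrite /majorant big_ord_recr /= lerDr sumr_ge0 // => i _; exact: majorant_term_ge0.
have maj0 : 0 <= majorant K x := majorant_ge0 K x.
have tail : \sum_(i < d) avg (iota K d) (majorant_term (K + i.+1)) x <=
    6 * (MR (K + d) / MR K) * majorant K x.
  apply: (@le_trans _ _ (\sum_(i < d) 3 * (MR (K + i.+1) / MR K) * majorant K x)).
    apply: ler_sum => i _.
    have -> : iota K d = iota K i.+1 ++ iota (K + i.+1) (d - i.+1).
      by rewrite -iotaD subnKC.
    rewrite avg_cat (avg_level_id m_ge2 _ (@majorant_term_level (K + i.+1))) //.
    apply: (le_trans (avg_majorant_term _ _ _)).
    by rewrite ler_wpM2l // mulr_ge0 // divr_ge0.
  rewrite -mulr_suml ler_wpM2r // -mulr_sumr -mulr_suml.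
  have -> : 6 = 3 * 2 :> R by rewrite -natrM.
  rewrite -!mulrA ler_wpM2l // mulrA ler_wpM2r ?invr_ge0 //.
  apply: (@le_trans _ _ (\sum_(i < d.+1) MR (K + i))).
    rewrite big_ord_recl /= -[leLHS]add0r lerD //.
  have -> : 2 = 2 / (2 - 1) :> R by field; lra.
  apply: (@sum_geometric_le 2 (fun k => MR (K + k))) => [|k|//]; first by lra.
  rewrite addnS -natrM ler_nat.
  exact: vilenkin_M_double.
have : majorant K x <= MR (K + d) / MR K * majorant K x.
  rewrite -[leLHS]mul1r ler_wpM2r // ler_pdivlMr // mul1r ler_nat.
  by rewrite leq_vilenkin_M // leq_addr.
lra.
Qed.

Lemma mean_spikeR B s l : (forall k, (m k <= B)%N) ->
  mean l (spikeR s l) <= B%:R / MR l.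
Proof.
move=> mB.
suff -> : mean l (spikeR s l) = (if (s < l)%N then m s else 1%N)%:R / MR l.
  rewrite ler_wpM2r ?invr_ge0 // ler_nat; case: ifP => // _.
  by apply: leq_trans (mB 0%N); apply: ltnW.
elim: l s => [|l IH] s.
  by rewrite /mean /= vilenkin_M0 invr1 mulr1.
rewrite /mean -addn1 iotaD avg_cat addn1 add0n /= coord_avg_spikeR vilenkin_MS natrM.
have := mR_neq0 m_ge2 R l; have := vilenkin_MR_neq0 R m_ge2 l.
case: (eqVneq s l) => [->|sl].
  rewrite -[avg _ _ _]/(mean l (spikeR l l)) IH ltnn ltnSn.
  set a := (m l)%:R; set b := MR l => a0 b0.
  by field; rewrite a0 b0.
rewrite avgMl -[avg _ _ _]/(mean l (spikeR s l)) IH ltnS.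
rewrite [(s <= l)%N]leq_eqVlt (negPf sl) /=.
set a := (m l)%:R; set b := MR l => a0 b0.
by field; rewrite a0 b0.
Qed.

Lemma sum_decreasing_le (r : R) (a : nat -> R) n : 0 <= r < 1 ->
  (forall k, a k.+1 <= r * a k) -> (forall k, 0 <= a k) ->
  \sum_(k < n) a k <= a 0 / (1 - r).
Proof.
move=> /andP[r0 r1] ha a0; have r1' : 0 < 1 - r by lra.
rewrite ler_pdivlMr //.
suff : (\sum_(k < n) a k) * (1 - r) <= a 0 - a n by have := a0 n; lra.
elim: n => [|n IH]; first by rewrite big_ord0; lra.
rewrite big_ord_recr /=; have := ha n; lra.
Qed.

Lemma powR_vilenkin_M_ge (p : R) l : 0 <= p -> 2 `^ p * MR l `^ p <= MR l.+1 `^ p.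
Proof.
move=> p0; rewrite -powRM // ge0_ler_powR ?nnegrE ?mulr_ge0 //.
by rewrite -natrM ler_nat vilenkin_M_double.
Qed.

(** The pair [(l, s)] contributes [(M_l M_s)^p] on a set of measure at most [B / M_l]. The sum over
    [s <= l] is geometric, with [M_l^p] as dominant term, which leaves [M_l^(2p-1)]. *)
Lemma mean_majorant_powR (p : R) B : 0 < p <= 1 -> (forall k, (m k <= B)%N) ->
  exists2 C : R, 0 <= C & forall K,
    mean K (fun x => majorant K x `^ p) <= C * \sum_(l < K.+1) MR l `^ (2 * p - 1).
Proof.
move=> p01 mB; have /andP[p0 p1] := p01.
have rho1 := lt1_powR2 p0.
exists (B%:R * (2 `^ p / (2 `^ p - 1))).
  by rewrite mulr_ge0 // divr_ge0 ?powR_ge0 // subr_ge0 ltW.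
move=> K; rewrite mulr_sumr.
have termE l x : majorant_term l x = \sum_(s < l.+1) MR l * MR s * spikeR s l x.
  rewrite big_ord_recr /= /majorant_term /majorant_off mulr_sumr; congr (_ + _).
  by apply: eq_bigr => s _; rewrite mulrA.
have bound x : majorant K x `^ p <=
    \sum_(l < K.+1) \sum_(s < l.+1) (MR l * MR s) `^ p * spikeR s l x.
  apply: (le_trans (powR_sum_le _ p01 _)) => [l _|]; first exact: majorant_term_ge0.
  apply: ler_sum => l _; rewrite termE.
  apply: (le_trans (powR_sum_le _ p01 _)) => [s _|].
    by rewrite mulr_ge0 // spikeR_ge0.
  apply: ler_sum => s _; rewrite powRM ?spikeR_ge0 ?mulr_ge0 //.
  rewrite /spikeR; case: (spike s l x); first by rewrite powR1.
  by rewrite powR0 // gt_eqF.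
apply: (le_trans (ler_mean _ bound)); rewrite /mean avg_sum.
apply: ler_sum => l _; rewrite avg_sum.
have meanE s : (s < l.+1)%N ->
    avg (iota 0 K) (fun x => (MR l * MR s) `^ p * spikeR s l x) 0 <=
    (B%:R * MR l `^ (p - 1)) * MR s `^ p.
  move=> _; rewrite avgMl -/(mean K _) (mean_levelE m_ge2 (K := l));
    last exact: spikeR_level.
    rewrite powRM // powRB ?powRr1 ?vilenkin_MR_neq0 ?implybT //.
    have := mean_spikeR s l mB.
    move=> /(ler_wpM2l (mulr_ge0 (powR_ge0 (MR l) p) (powR_ge0 (MR s) p)))
    /le_trans; apply; rewrite le_eqVlt; apply/orP; left; apply/eqP; ring.
  by rewrite -ltnS.
apply: (@le_trans _ _ (\sum_(s < l.+1) (B%:R * MR l `^ (p - 1)) * MR s `^ p)).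
  by apply: ler_sum => s _; apply: meanE.
have geo : \sum_(s < l.+1) MR s `^ p <= 2 `^ p / (2 `^ p - 1) * MR l `^ p.
  apply: (@sum_geometric_le _ (fun s => MR s `^ p)) => //.
  by move=> k; apply: powR_vilenkin_M_ge; exact: ltW.
rewrite -mulr_sumr; apply: (le_trans (ler_wpM2l _ geo)).
  by rewrite mulr_ge0 ?powR_ge0.
have -> : 2 * p - 1 = (p - 1) + p by ring.
rewrite [X in _ <= _ * X]powRD ?vilenkin_MR_neq0 ?implybT //.
by rewrite le_eqVlt; apply/orP; left; apply/eqP; ring.
Qed.

End kernel_majorant.

(** * Characters and kernels *)

Section characters.
Variables (R : realType) (m : nat -> nat).
Hypothesis m_ge2 : forall k, (2 <= m k)%N.
Local Notation V := (vilenkin m).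
Local Notation M := (@vilenkin_M m).
Local Notation C := R[i].
Local Notation normc := (@Normc.normc R).
Local Notation rad := (@rademacher R m).
Local Notation psi := (@vilenkin_psi R m).
Local Notation digit := (@vilenkin_digit m).
Implicit Types (x y : V) (s l n k K N : nat) (t u : R) (z : C).

Definition cis t : C := (cos t +i* sin t)%C.

Lemma cisD t u : cis (t + u) = cis t * cis u.
Proof.
apply/eqP; rewrite /cis cosD sinD eq_complex /= [_ + sin t * _]addrC.
by rewrite [cos t * sin u]mulrC [sin u * _]mulrC !eqxx.
Qed.

Lemma cis0 : cis 0 = 1. Proof. by rewrite /cis cos0 sin0. Qed.

Lemma cis_natmul t n : cis (t *+ n) = cis t ^+ n.
Proof. by elim: n => [|n IH]; rewrite ?cis0 ?expr0 // mulrS exprS cisD IH. Qed.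

Lemma cis_2pi : cis (2 * pi) = 1.
Proof. by rewrite mulr_natl /cis cos2pi sin2pi. Qed.

Lemma normc_cis t : normc (cis t) = 1.
Proof. by rewrite /= cos2Dsin2 sqrtr1. Qed.

Lemma mulr_conjc z : normc z = 1 -> z * (z^*)%C = 1.
Proof.
case: z => a b /= h; apply/eqP; rewrite eq_complex /=.
have -> : a * - b + b * a = 0 by ring.
rewrite eqxx andbT mulrN opprK -!expr2 -[X in X == _]sqr_sqrtr ?addr_ge0 ?sqr_ge0 //.
by rewrite h expr1n.
Qed.

Lemma rademacherE k x : rad k x = cis (2 * pi / (m k)%:R) ^+ crd x k.
Proof. by rewrite -cis_natmul /rademacher /cis mulrAC mulr_natr. Qed.

Lemma cis_root k : cis (2 * pi / (m k)%:R) ^+ m k = 1.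
Proof. by rewrite -cis_natmul -[_ *+ m k]mulr_natr divfK ?cis_2pi // mR_neq0. Qed.

Lemma rademacher_root k x : rad k x ^+ m k = 1.
Proof. by rewrite rademacherE -exprM mulnC exprM cis_root expr1n. Qed.

Lemma rademacherD k x y : rad k (x + y) = rad k x * rad k y.
Proof.
rewrite !rademacherE -exprD -[RHS](expr_mod _ (cis_root k)) crdD.
by rewrite -[X in (_ %% X)%N](Zp_cast (m_ge2 k)).
Qed.

Lemma rademacher0 k : rad k 0 = 1.
Proof. by rewrite rademacherE crd0 expr0. Qed.

Lemma normcX z n : normc (z ^+ n) = normc z ^+ n.
Proof.
elim: n => [|n IH]; first by rewrite !expr0 Normc.normc1.
by rewrite !exprS Normc.normcM IH.
Qed.

Lemma normc_rademacher k x : normc (rad k x) = 1.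
Proof. by rewrite rademacherE normcX normc_cis expr1n. Qed.

Lemma rademacher_level k : level k.+1 (rad k).
Proof. by move=> x y xy; rewrite !rademacherE xy. Qed.

(** With half-angle [t] the real part is [1 - 2 sin^2 t], and a nonzero coordinate puts [t] strictly
    between [0] and [pi]. *)
Lemma rademacher_eq1 k x : rad k x = 1 -> crd x k = 0.
Proof.
move=> radx; apply/eqP; apply: contra_eqT radx => xk0.
rewrite rademacherE -cis_natmul -[_ *+ crd x k]mulr_natr.
set a : R := (crd x k)%:R.
have a0 : 0 < a by rewrite ltr0n lt0n.
have am : a < (m k)%:R.
  by rewrite ltr_nat -[ltnRHS](Zp_cast (m_ge2 k)) ltn_ord.
have mk0 := mR_gt0 m_ge2 R k.
have -> : 2 * pi / (m k)%:R * a = (pi * (a / (m k)%:R)) *+ 2.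
  by rewrite mulr2n; field; rewrite gt_eqF.
set t := pi * _.
have s0 : 0 < sin t.
  apply: sin_gt0_pi; rewrite mulr_gt0 ?divr_gt0 ?pi_gt0 //=.
  by rewrite -[ltRHS]mulr1 ltr_pM2l ?pi_gt0 // ltr_pdivrMr // mul1r.
rewrite eq_complex /= negb_and cos_mulr2n cos2sin2; apply/orP; left.
rewrite -subr_eq0 lt_eqF //; have : 0 < sin t ^+ 2 by rewrite exprn_gt0.
lra.
Qed.

Lemma sum_rademacher k x :
  \sum_(j < m k) rad k x ^+ j = ((m k)%:R * (crd x k == 0)%:R).
Proof.
have [xk|xk] := eqVneq (crd x k) 0.
  have -> : rad k x = 1 by rewrite rademacherE xk expr0.
  by under eq_bigr do rewrite expr1n; rewrite sumr_const card_ord mulr1.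
apply/eqP; rewrite mulr0 -(mulrI_eq0 _ (x := rad k x - 1)).
  by rewrite -subrX1 rademacher_root subrr.
apply/lregP; rewrite subr_eq0; apply: contra xk => /eqP /rademacher_eq1 ->.
exact: eqxx.
Qed.

Definition psi_upto K n x : C := \prod_(k < K) rad k x ^+ digit n k.

Lemma digit_small n k : (n < M k)%N -> digit n k = 0%N.
Proof. by move=> nM; rewrite /vilenkin_digit divn_small // mod0n. Qed.

Lemma psi_upto_add K d n x : (n < M K)%N -> psi_upto (K + d) n x = psi_upto K n x.
Proof.
move=> nM; rewrite /psi_upto big_split_ord /= [X in _ * X]big1 ?mulr1 // => i _.
by rewrite digit_small // (leq_trans nM) // leq_vilenkin_M // leq_addr.
Qed.

(** [psi n] multiplies over the first [n] digits only. Both truncations equal the one at [K + n],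
    the digits in between being zero. *)
Lemma psi_uptoE K n x : (n < M K)%N -> psi n x = psi_upto K n x.
Proof.
move=> nM; rewrite -(psi_upto_add n _ nM) addnC psi_upto_add //.
exact: ltn_vilenkin_M.
Qed.

Lemma dvdn_vilenkin_M k l : (k < l)%N -> (M k * m k %| M l)%N.
Proof.
rewrite -vilenkin_MS => /subnKC <-; elim: (l - _)%N => [|d IH]; first by rewrite addn0.
by rewrite addnS [X in (_ %| X)%N]vilenkin_MS dvdn_mulr.
Qed.

Lemma digit_low l j n k : (k < l)%N -> digit (j * M l + n) k = digit n k.
Proof.
move=> /dvdn_vilenkin_M /dvdnP[q ->]; rewrite /vilenkin_digit.
have -> : (j * (q * (M k * m k)) + n = (j * q * m k) * M k + n)%N by ring.
by rewrite divnMDl ?vilenkin_M_gt0 // modnMDl.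
Qed.

Lemma digit_top l j n : (j < m l)%N -> (n < M l)%N -> digit (j * M l + n) l = j.
Proof.
move=> jm nM; rewrite /vilenkin_digit divnMDl ?vilenkin_M_gt0 //.
by rewrite divn_small // addn0 modn_small.
Qed.

Lemma vilenkin_psiMD l j n x : (j < m l)%N -> (n < M l)%N ->
  psi (j * M l + n) x = rad l x ^+ j * psi n x.
Proof.
move=> jm nM; rewrite (@psi_uptoE l.+1); last first.
  rewrite vilenkin_MS [ltnRHS]mulnC; apply: (@leq_trans (j.+1 * M l)%N).
    by rewrite mulSn [ltnRHS]addnC ltn_add2l.
  by rewrite leq_mul2r jm orbT.
rewrite /psi_upto big_ord_recr /= digit_top // mulrC; congr (_ * _).
rewrite (psi_uptoE _ nM); apply: eq_bigr => k _.
by rewrite digit_low.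
Qed.

Lemma vilenkin_psiD n x y : psi n (x + y) = psi n x * psi n y.
Proof.
rewrite /vilenkin_psi -big_split; apply: eq_bigr => k _.
by rewrite rademacherD exprMn.
Qed.

Lemma normc_psi n x : normc (psi n x) = 1.
Proof.
rewrite /vilenkin_psi; elim/big_ind : _ => [|a b a1 b1|k _].
- exact: Normc.normc1.
- by rewrite Normc.normcM a1 b1 mulr1.
- by rewrite normcX normc_rademacher expr1n.
Qed.

Lemma vilenkin_psi0 n : psi n 0 = 1.
Proof.
by rewrite /vilenkin_psi big1 // => k _; rewrite rademacher0 expr1n.
Qed.

Lemma vilenkin_psiB n x y : psi n (x - y) = psi n x * (psi n y)^*%C.
Proof.
rewrite vilenkin_psiD; congr (_ * _).
rewrite -[LHS]mulr1 -(mulr_conjc (normc_psi n y)) mulrA -vilenkin_psiD.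
by rewrite addNr vilenkin_psi0 mul1r.
Qed.

Lemma vilenkin_psi_level K n : (n < M K)%N -> level K (psi n).
Proof.
move=> nM x y xy; rewrite !(psi_uptoE _ nM); apply: eq_bigr => k _.
by rewrite (@rademacher_level k x y) //; apply: agreeW xy.
Qed.

End characters.

(** * Dirichlet kernels, Fejer sums and the weighted kernel *)

Section kernels.
Variables (R : realType) (m : nat -> nat).
Hypothesis m_ge2 : forall k, (2 <= m k)%N.
Local Notation V := (vilenkin m).
Local Notation M := (@vilenkin_M m).
Local Notation MR n := ((@vilenkin_M m n)%:R : R).
Local Notation C := R[i].
Local Notation normc := (@Normc.normc R).
Local Notation rad := (@rademacher R m).
Local Notation psi := (@vilenkin_psi R m).
Local Notation spikeR := (@spikeR R m).
Local Notation majorant_off := (@majorant_off R m).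
Local Notation majorant_term := (@majorant_term R m).
Local Notation majorant := (@majorant R m).
Implicit Types (x y : V) (s l n k K N : nat) (t u : R) (z : C).

Lemma normc_ge0 z : 0 <= normc z.
Proof. by case: z => a b; exact: sqrtr_ge0. Qed.

Lemma normc_real t : normc (t%:C)%C = `|t|.
Proof. by rewrite /= expr0n addr0 sqrtr_sqr. Qed.

Lemma normc_nat n : normc n%:R = n%:R.
Proof. by rewrite -(rmorph_nat (real_complex R)) normc_real ger0_norm. Qed.

Lemma ler_normcD z z' : normc (z + z') <= normc z + normc z'.
Proof. exact: le_normcD. Qed.

Lemma ler_normcB z z' : normc (z - z') <= normc z + normc z'.
Proof. by rewrite -(normcN z'); exact: le_normcD. Qed.

Lemma normc_sum (I : Type) (r : seq I) (P : pred I) (F : I -> C) :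
  normc (\sum_(i <- r | P i) F i) <= \sum_(i <- r | P i) normc (F i).
Proof.
elim/big_rec2 : _ => [|i y z _ IH]; first by rewrite Normc.normc0.
by apply: (le_trans (ler_normcD _ _)); rewrite lerD2l.
Qed.

Lemma normc_avg (r : seq nat) (g : V -> C) x :
  normc (avg r g x) <= avg r (fun y => normc (g y)) x.
Proof.
elim: r x => //= k r IH x; rewrite /coord_avg Normc.normcM Normc.normcV normc_nat.
rewrite ler_wpM2l ?invr_ge0 //; apply: (le_trans (normc_sum _ _ _)).
by apply: ler_sum => a _.
Qed.

Definition dirichlet n x : C := \sum_(k < n) psi k x.

(* [fejer_sum n = n K_n] in terms of the Fejer kernels [K_n]. *)
Definition fejer_sum n x : C := \sum_(k < n) dirichlet k x.

Lemma dirichletMD l j n x : (j < m l)%N -> (n <= M l)%N ->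
  dirichlet (j * M l + n) x = dirichlet (j * M l) x + rad l x ^+ j * dirichlet n x.
Proof.
move=> jm nM; rewrite /dirichlet big_split_ord /=; congr (_ + _).
rewrite mulr_sumr; apply: eq_bigr => k _.
by rewrite vilenkin_psiMD // (leq_trans _ nM).
Qed.

Lemma dirichletM l j x : (j <= m l)%N ->
  dirichlet (j * M l) x = (\sum_(i < j) rad l x ^+ i) * dirichlet (M l) x.
Proof.
elim: j => [|j IH] jm; first by rewrite /dirichlet mul0n !big_ord0 mul0r.
by rewrite mulSn addnC dirichletMD // IH 1?ltnW // big_ord_recr mulrDl.
Qed.

(** Paley's formula: passing from [l] to [l.+1] multiplies by the geometric sum of [rad l x], which
    is [m l] or zero. *)
Lemma dirichlet_M l x : dirichlet (M l) x = (MR l * spikeR l l x)%:C%C.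
Proof.
elim: l => [|l IH].
  rewrite /dirichlet vilenkin_M0 big_ord1 /vilenkin_psi big_ord0.
  by rewrite /spikeR /= mulr1.
rewrite vilenkin_MS mulnC dirichletM // sum_rademacher // IH /spikeR /= ltn_eqF //=.
rewrite spike_out // natrM !rmorphM /= -mulnb natrM !rmorphM !rmorph_nat /=.
by ring.
Qed.

Lemma normc_dirichletM l j x : (j <= m l)%N ->
  normc (dirichlet (j * M l) x) <= j%:R * (MR l * spikeR l l x).
Proof.
move=> jm; rewrite dirichletM // Normc.normcM dirichlet_M normc_real.
rewrite ger0_norm ?mulr_ge0 ?spikeR_ge0 //.
rewrite ler_wpM2r ?mulr_ge0 ?spikeR_ge0 //; apply: (le_trans (normc_sum _ _ _)).
rewrite (eq_bigr (fun=> 1)) => [|i _]; last by rewrite normcX normc_rademacher // expr1n.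
by rewrite sumr_const card_ord.
Qed.

(** Each of the last [n] Dirichlet kernels contains a full copy of the one of order [j * M l]. *)
Lemma fejer_sumMD l j n x : (j < m l)%N -> (n <= M l)%N ->
  fejer_sum (j * M l + n) x =
  fejer_sum (j * M l) x + n%:R * dirichlet (j * M l) x + rad l x ^+ j * fejer_sum n x.
Proof.
move=> jm nM; rewrite /fejer_sum big_split_ord /= -addrA; congr (_ + _).
rewrite (eq_bigr (fun k : 'I_n => dirichlet (j * M l) x + rad l x ^+ j * dirichlet k x)).
  by rewrite big_split /= sumr_const card_ord mulr_natl mulr_sumr.
move=> k _; rewrite dirichletMD //; exact: leq_trans (ltnW (ltn_ord k)) nM.
Qed.

Lemma fejer_sumM l j x : (j <= m l)%N ->
  fejer_sum (j * M l) x = (M l)%:R * (\sum_(i < j) dirichlet (i * M l) x)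
    + (\sum_(i < j) rad l x ^+ i) * fejer_sum (M l) x.
Proof.
elim: j => [|j IH] jm.
  by rewrite mul0n /fejer_sum !big_ord0 mulr0 mul0r addr0.
rewrite mulSn addnC fejer_sumMD // IH 1?ltnW // !big_ord_recr /=; ring.
Qed.

Lemma normc_sum_dirichletM l j x : (j <= m l)%N ->
  normc (\sum_(i < j) dirichlet (i * M l) x) <= j%:R ^+ 2 * (MR l * spikeR l l x).
Proof.
move=> jm; apply: (le_trans (normc_sum _ _ _)).
apply: (@le_trans _ _ (\sum_(i < j) j%:R * (MR l * spikeR l l x))).
  apply: ler_sum => i _; have im : (i <= m l)%N by apply: leq_trans jm; exact: ltnW.
  apply: (le_trans (normc_dirichletM _ im)).
  by rewrite ler_wpM2r ?mulr_ge0 ?spikeR_ge0 // ler_nat ltnW.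
by rewrite sumr_const card_ord -[leLHS]mulr_natl mulrA -expr2.
Qed.

Variable B : nat.
Hypothesis m_le : forall k, (m k <= B)%N.

(** The recursion at [j = m l] mirrors that of [majorant_off]: the old sum survives, times [m l],
    where coordinate [l] vanishes, and the new Dirichlet kernels live on the spike with free
    coordinate [l]. *)
Lemma normc_fejer_sum_M l x : normc (fejer_sum (M l) x) <= B%:R * majorant_off l x.
Proof.
elim: l => [|l IH].
  rewrite vilenkin_M0 /fejer_sum big_ord1 /dirichlet big_ord0 Normc.normc0.
  by rewrite mulr_ge0 // majorant_off_ge0.
rewrite vilenkin_MS mulnC fejer_sumM // sum_rademacher //.
apply: (le_trans (ler_normcD _ _)); rewrite !Normc.normcM !normc_nat.
have offS : majorant_off l.+1 x = (m l)%:R * ((crd x l == 0)%:R * majorant_off l x)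
    + (m l)%:R * (MR l * (MR l * spikeR l l x)).
  rewrite /majorant_off big_ord_recr /= vilenkin_MS natrM mulrDr; congr (_ + _).
    rewrite !mulr_sumr; apply: eq_bigr => s _; rewrite /spikeR /= gtn_eqF //=.
    by rewrite -mulnb natrM; ring.
  by rewrite /spikeR /= eqxx andbT; ring.
rewrite offS mulrDr [leLHS]addrC.
have mB : (m l)%:R <= B%:R :> R by rewrite ler_nat.
apply: lerD.
  set c := (crd x l == 0)%:R.
  have -> : B%:R * ((m l)%:R * (c * majorant_off l x)) =
    (m l)%:R * c * (B%:R * majorant_off l x) by ring.
  by rewrite ler_wpM2l // mulr_ge0.
have := normc_sum_dirichletM x (leqnn (m l)).
move=> /(ler_wpM2l (ler0n R (M l))) /le_trans; apply.
set u := MR l * spikeR l l x.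
have u0 : 0 <= MR l * u by rewrite !mulr_ge0 ?spikeR_ge0.
have -> : MR l * ((m l)%:R ^+ 2 * u) = (m l)%:R * ((m l)%:R * (MR l * u)) by ring.
by rewrite ler_wpM2r ?mulr_ge0.
Qed.

(** Each step of the recursion produces two diagonal contributions, both at most [B^2 M_l^2] on the
    cylinder of rank [l]; hence the constant [2 B^2]. *)
Lemma normc_fejer_sum_le l n x : (n <= M l.+1)%N ->
  normc (fejer_sum n x) <= 2 * B%:R ^+ 2 * majorant l x.
Proof.
suff {l n} main l n : (n <= M l)%N ->
    normc (fejer_sum n x) <= 2 * B%:R ^+ 2 * \sum_(j < l) majorant_term j x.
  exact: main.
elim: l n => [|l IH] n.
  rewrite vilenkin_M0 big_ord0 mulr0; case: n => [_|[_|//]].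
    by rewrite /fejer_sum big_ord0 Normc.normc0.
  by rewrite /fejer_sum big_ord1 /dirichlet big_ord0 Normc.normc0.
have rhs0 k : 0 <= 2 * B%:R ^+ 2 * \sum_(j < k) majorant_term j x.
  by rewrite !mulr_ge0 ?exprn_ge0 // sumr_ge0 // => j _; exact: majorant_term_ge0.
case: n => [_|n nM].
  by rewrite /fejer_sum big_ord0 Normc.normc0.
have M0 := vilenkin_M_gt0 m_ge2 l.
have jm : (n %/ M l < m l)%N by rewrite ltn_divLR // mulnC -vilenkin_MS.
have n'M : ((n %% M l).+1 <= M l)%N by rewrite ltn_mod.
(* The division is applied to the predecessor, so that the remainder ranges over [1, ..., M l] and
   [j < m l] holds even for the index [M l.+1] itself. *)
rewrite (divn_eq n (M l)) -addnS; move: (n %/ M l)%N jm => j jm.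
move: (n %% M l).+1 n'M => {nM} {}n nM.
rewrite fejer_sumMD // fejer_sumM 1?ltnW //.
set e := spikeR l l x; set o := majorant_off l x.
have e0 : 0 <= e := spikeR_ge0 R _ _ _.
have o0 : 0 <= o := majorant_off_ge0 R _ _.
have b1 := normc_sum_dirichletM x (ltnW jm); rewrite -/e in b1.
have b2 := normc_dirichletM x (ltnW jm); rewrite -/e in b2.
have b3 := normc_fejer_sum_M l x; rewrite -/o in b3.
have b4 := IH n nM.
have b5 : normc (\sum_(i < j) rad l x ^+ i) <= j%:R.
  apply: (le_trans (normc_sum _ _ _)).
  rewrite (eq_bigr (fun=> 1)) => [|i _]; last first.
    by rewrite normcX normc_rademacher // expr1n.
  by rewrite sumr_const card_ord.
have jB : j%:R <= B%:R :> R by rewrite ler_nat (leq_trans (ltnW jm)).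
have B1 : 1 <= B%:R :> R by rewrite ler1n (leq_trans _ (m_le 0)) // ltnW.
have nMR : n%:R <= MR l by rewrite ler_nat.
have jB2 : j%:R ^+ 2 <= B%:R ^+ 2 :> R by rewrite lerXn2r ?nnegrE.
have jBB : j%:R <= B%:R ^+ 2 :> R by rewrite expr2 (le_trans jB) // ler_peMl.
apply: (le_trans (ler_normcD _ _)).
rewrite Normc.normcM normcX normc_rademacher // expr1n mul1r.
rewrite big_ord_recr /= mulrDr addrC lerD //.
apply: (le_trans (ler_normcD _ _)); rewrite Normc.normcM normc_nat.
have c2 : n%:R * normc (dirichlet (j * M l) x) <= MR l * (B%:R ^+ 2 * (MR l * e)).
  apply: ler_pM => //; first exact: normc_ge0.
  apply: (le_trans b2); rewrite ler_wpM2r ?mulr_ge0 //.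
have c1 : MR l * normc (\sum_(i < j) dirichlet (i * M l) x) <=
    MR l * (B%:R ^+ 2 * (MR l * e)).
  rewrite ler_wpM2l //; apply: (le_trans b1).
  by rewrite ler_wpM2r ?mulr_ge0.
have c3 : normc (\sum_(i < j) rad l x ^+ i) * normc (fejer_sum (M l) x) <= B%:R ^+ 2 * o.
  rewrite expr2 -mulrA; apply: ler_pM => //; rewrite ?normc_ge0 //.
  exact: le_trans b5 jB.
have := ler_normcD ((M l)%:R * \sum_(i < j) dirichlet (i * M l) x)
  ((\sum_(i < j) rad l x ^+ i) * fejer_sum (M l) x).
rewrite !Normc.normcM normc_nat /majorant_term -/e -/o => c0.
have c4 : 0 <= B%:R ^+ 2 * o by rewrite mulr_ge0 ?exprn_ge0.
have -> : 2 * B%:R ^+ 2 * (o + MR l ^+ 2 * e) =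
  2 * (B%:R ^+ 2 * o) + 2 * (MR l * (B%:R ^+ 2 * (MR l * e))) by ring.
lra.
Qed.

Variable q : nat -> R.
Hypothesis q_ge0 : forall k, 0 <= q k.
Hypothesis q_nondecreasing : forall i j, (i <= j)%N -> q i <= q j.

Definition weighted_kernel n x : C := \sum_(k < n) (q k)%:C%C * dirichlet k x.

Lemma weighted_kernel_abel n x :
  weighted_kernel n.+1 x = (q n)%:C%C * fejer_sum n.+1 x
    - \sum_(k < n) (q k.+1 - q k)%:C%C * fejer_sum k.+1 x.
Proof.
elim: n => [|n IH].
  by rewrite /weighted_kernel /fejer_sum !big_ord1 big_ord0 subr0.
rewrite /weighted_kernel big_ord_recr -/(weighted_kernel n.+1 x) /= IH.
rewrite [in RHS]big_ord_recr /= [fejer_sum n.+2 x]big_ord_recr /= -/(fejer_sum n.+1 x).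
by rewrite rmorphB /=; ring.
Qed.

(** By monotonicity the total variation of the weights telescopes to [q n - q 0], so boundary term
    and sum together cost at most [2 * q n]. *)
Lemma normc_weighted_kernel l n x : (n.+1 <= M l.+1)%N ->
  normc (weighted_kernel n.+1 x) <= 2 * q n * (2 * B%:R ^+ 2 * majorant l x).
Proof.
move=> nM; set b := 2 * B%:R ^+ 2 * majorant l x.
have fb k : (k <= n)%N -> normc (fejer_sum k.+1 x) <= b.
  by move=> kn; apply: normc_fejer_sum_le; apply: leq_trans nM.
have b0 : 0 <= b by rewrite !mulr_ge0 ?exprn_ge0 // majorant_ge0.
rewrite weighted_kernel_abel; apply: (le_trans (ler_normcB _ _)).
rewrite Normc.normcM normc_real ger0_norm //.
have h1 : q n * normc (fejer_sum n.+1 x) <= q n * b by rewrite ler_wpM2l // fb.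
have h2 : normc (\sum_(k < n) (q k.+1 - q k)%:C%C * fejer_sum k.+1 x) <= (q n - q 0) * b.
  apply: (le_trans (normc_sum _ _ _)).
  have -> : q n - q 0 = \sum_(k < n) (q k.+1 - q k).
    by rewrite -(big_mkord predT (fun k => q k.+1 - q k)) telescope_sumr.
  rewrite mulr_suml; apply: ler_sum => k _; rewrite Normc.normcM normc_real.
  have q0 : 0 <= q k.+1 - q k by rewrite subr_ge0 q_nondecreasing.
  by rewrite ger0_norm // ler_wpM2l // fb // ltnW.
have : 0 <= q 0 * b by rewrite mulr_ge0.
lra.
Qed.

End kernels.

(** * Weights *)

Section weights.
Variables (R : realType) (p : R).
Hypothesis p_gt0 : 0 < p.
Hypothesis p_le : p <= 2^-1.

Definition weight (n : nat) : R :=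
  n.+1%:R `^ (p^-1 - 2) * ln n.+1%:R ^ (2 * Num.floor (2^-1 + p)).

Lemma weight_small n : p < 2^-1 -> weight n = n.+1%:R `^ (p^-1 - 2).
Proof.
move=> p2; rewrite /weight.
have -> : Num.floor (2^-1 + p) = 0.
  apply: floor_def; rewrite add0r mulr0z mulr1z; apply/andP; split; have := p_gt0; lra.
by rewrite mulr0 expr0z mulr1.
Qed.

Lemma weight_half n : p = 2^-1 -> weight n = ln n.+1%:R ^+ 2.
Proof.
move=> p2; rewrite /weight.
have -> : Num.floor (2^-1 + p) = 1.
  apply: floor_def; rewrite mulr1z p2 -[(1 + 1)%:~R]/(2%:R).
  by apply/andP; split; lra.
by rewrite p2 invrK subrr powRr0 mul1r.
Qed.

Lemma weight_gt0 n : (0 < n)%N -> 0 < weight n.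
Proof.
move=> n0; rewrite /weight mulr_gt0 ?powR_gt0 // exprz_gt0 // ln_gt0 //.
by rewrite ltr1n.
Qed.

Lemma weight_le n n' : (0 < n)%N -> (n <= n')%N -> weight n <= weight n'.
Proof.
move=> n0 nn'; have := p_le; rewrite le_eqVlt => /orP[/eqP p2|p2].
  rewrite !weight_half // lerXn2r ?nnegrE ?ln_ge0 ?ler1n //.
  by rewrite ler_ln ?posrE ?ltr0n // ler_nat.
rewrite !weight_small // ge0_ler_powR ?nnegrE ?ler0n ?ler_nat //.
rewrite subr_ge0 -[leLHS]invrK lef_pV2 ?posrE ?invr_gt0 //.
Qed.

Variable m : nat -> nat.
Hypothesis m_ge2 : forall k, (2 <= m k)%N.
Local Notation MR n := ((@vilenkin_M m n)%:R : R).
Variable B : nat.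
Hypothesis m_le : forall k, (m k <= B)%N.

(** The mean of the two lower bounds [ln 2] and [K ln 2]; it stays positive at [K = 0]. *)
Lemma ln_vilenkin_M_ge K : ln 2 * K.+1%:R / 2 <= ln (@vilenkin_M m K).+1%:R :> R.
Proof.
have ln2 : 0 < ln 2 :> R by rewrite ln_gt0 // ltr1n.
have h1 : ln 2 <= ln (@vilenkin_M m K).+1%:R :> R.
  by rewrite ler_ln ?posrE ?ltr0n // ler_nat ltnS vilenkin_M_gt0.
have h2 : ln 2 * K%:R <= ln (@vilenkin_M m K).+1%:R :> R.
  rewrite mulr_natr -lnXn // ler_ln ?posrE ?exprn_gt0 ?ltr0n //.
  by rewrite -natrX ler_nat (leq_trans (leq_exp2_vilenkin_M m_ge2 K)).
move: h1 h2; set L := ln (vilenkin_M K).+1%:R; rewrite -[K.+1%:R]natr1; lra.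
Qed.

(** For [p = 1/2] the sum of [M_l^(2p-1)] is [K + 1], which the logarithm of [M_K + 1] dominates.
    For [p < 1/2] that sum is bounded by a geometric series of ratio [2^(2p-1)], and
    [(1/p - 2) p = 1 - 2p] makes the weight cancel [M_K^(1-2p)]. *)
Lemma weighted_mean_majorant : exists2 C : R, 0 <= C & forall K,
  (weight (@vilenkin_M m K))^-1 `^ p * MR K `^ (1 - 2 * p) *
    mean K (fun x => @majorant R m K x `^ p) <= C.
Proof.
have p0 := p_gt0.
have p01 : 0 < p <= 1 by rewrite p_gt0 (le_trans p_le) // invf_le1 ?ler1n.
have [C0 C00 hC0] := mean_majorant_powR m_ge2 p01 m_le.
have mean0 K : 0 <= mean K (fun x => @majorant R m K x `^ p).
  by apply: mean_ge0 => // x; exact: powR_ge0.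
have M0 K : 0 < MR K by exact: vilenkin_MR_gt0.
have := p_le; rewrite le_eqVlt => /orP[/eqP p2|p2].
  exists (C0 * (2 / ln 2)); first by rewrite mulr_ge0 // divr_ge0 // ln_ge0 // ler1n.
  move=> K; rewrite weight_half //.
  have ln2 : 0 < ln 2 :> R by rewrite ln_gt0 // ltr1n.
  have lnK := ln_vilenkin_M_ge K; set L := ln (vilenkin_M K).+1%:R in lnK *.
  have L0 : 0 < L by rewrite ln_gt0 // ltr1n ltnS vilenkin_M_gt0.
  have -> : (L ^+ 2)^-1 `^ p = L^-1.
    rewrite p2 powR12_sqrt ?invr_ge0 ?exprn_ge0 ?ltW // -exprVn sqrtr_sqr.
    by rewrite ger0_norm // invr_ge0 ltW.
  have -> : 1 - 2 * p = 0 by rewrite p2; lra.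
  rewrite powRr0 mulr1 mulrC ler_pdivrMr //.
  apply: (le_trans (hC0 K)); rewrite -!mulrA ler_wpM2l //.
  have -> : 2 * p - 1 = 0 by rewrite p2; lra.
  under eq_bigr do rewrite powRr0.
  rewrite sumr_const card_ord -[leLHS]mulr_natl mulr1.
  rewrite mulrA -ler_pdivrMl ?divr_gt0 // invf_div; lra.
have r01 : 0 <= 2 `^ (2 * p - 1) < 1.
  rewrite powR_ge0 /= -[ltRHS](powRr0 2) /powR !ifF ?gt_eqF // ltr_expR mul0r.
  by rewrite pmulr_llt0 ?ln_gt0 ?ltr1n //; lra.
have /andP[r0 r1] := r01.
exists (C0 * (1 / (1 - 2 `^ (2 * p - 1)))).
  by rewrite mulr_ge0 // divr_ge0 // subr_ge0 ltW.
move=> K; rewrite weight_small //.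
have w1 : ((@vilenkin_M m K).+1%:R `^ (p^-1 - 2))^-1 `^ p * MR K `^ (1 - 2 * p) <= 1.
  rewrite -powRN -powRrM.
  have -> : - (p^-1 - 2) * p = - (1 - 2 * p) by field; rewrite gt_eqF.
  rewrite powRN mulrC ler_pdivrMr ?powR_gt0 ?ltr0n // mul1r.
  rewrite ge0_ler_powR ?nnegrE ?ler0n ?ler_nat //; lra.
rewrite -[leRHS]mul1r ler_pM // ?mulr_ge0 ?powR_ge0 //.
apply: (le_trans (hC0 K)); rewrite ler_wpM2l //.
have := @sum_decreasing_le R _ (fun l => MR l `^ (2 * p - 1)) K.+1 r01.
rewrite vilenkin_M0 powR1; apply => [k|k]; last exact: powR_ge0.
have MKS : MR k.+1 `^ (2 * p - 1) <= (2 * MR k) `^ (2 * p - 1).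
  have neg : 2 * p - 1 = - (1 - 2 * p) by ring.
  rewrite neg !powRN lef_pV2 ?posrE ?powR_gt0 ?mulr_gt0 //.
  rewrite ge0_ler_powR ?nnegrE ?mulr_ge0 //; first by lra.
  by rewrite -natrM ler_nat vilenkin_M_double.
by rewrite powRM in MKS.
Qed.

End weights.

(** * Convolution with a piece of the decomposition *)

Section convolution.
Variables (R : realType) (m : nat -> nat).
Hypothesis m_ge2 : forall k, (2 <= m k)%N.
Local Notation V := (vilenkin m).
Local Notation M := (@vilenkin_M m).
Local Notation MR n := ((@vilenkin_M m n)%:R : R).
Local Notation C := R[i].
Local Notation normc := (@Normc.normc R).
Local Notation majorant := (@majorant R m).
Implicit Types (x y : V) (n k K N l : nat) (g : V -> C) (S : V -> bool).

Variables (ker : nat -> V -> C) (Cker : R).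
Hypothesis Cker_ge0 : 0 <= Cker.
Hypothesis ker_level : forall K n, (n <= M K)%N -> level K (ker n).
Hypothesis ker_le : forall l n x, (0 < n <= M l.+1)%N ->
  normc (ker n x) <= Cker / n%:R * majorant l x.

Variable N : nat.

Definition convol n g x : C := mean N (fun t => g t * ker n (x - t)).

Lemma convol_sum (I : Type) (r : seq I) (P : pred I) (G : I -> V -> C) n x :
  convol n (fun t => \sum_(i <- r | P i) G i t) x = \sum_(i <- r | P i) convol n (G i) x.
Proof.
rewrite /convol /mean; under eq_fun do rewrite mulr_suml.
by rewrite avg_sum.
Qed.

Lemma convolD n g g' x :
  convol n (fun t => g t + g' t) x = convol n g x + convol n g' x.
Proof.
rewrite /convol /mean; under eq_fun do rewrite mulrDl.
by rewrite avgD.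
Qed.

Lemma level_reflect (T : Type) K (h : V -> T) x :
  level K h -> level K (fun t => h (x - t)).
Proof. by move=> hK y z yz; apply: hK => k kK; rewrite !crdD !crdN yz. Qed.

Lemma convol_vanish K n g x : (K <= N)%N -> (n <= M K)%N ->
  avg (iota K (N - K)) g = (fun=> 0) -> convol n g x = 0.
Proof.
move=> KN nK g0; rewrite /convol (mean_split _ KN) (avgM_level (n := K)) //.
  by under eq_fun do rewrite g0 mul0r; rewrite /mean avg_cst.
by apply: level_reflect; apply: ker_level.
Qed.

Lemma exists_vilenkin_M n : (0 < n <= M N)%N ->
  exists2 l, (l <= N)%N & (M l <= n < M l.+1)%N.
Proof.
move=> /andP[n0 nN].
have nNS : (n < M N.+1)%N.
  apply: (leq_ltn_trans nN); apply: leq_trans (vilenkin_M_double m_ge2 N).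
  by rewrite mul2n -addnn -[ltnLHS]addn0 ltn_add2l vilenkin_M_gt0.
have ex : exists l, (n < M l.+1)%N by exists N.
exists (ex_minn ex); case: ex_minnP => l nl lmin; first exact: lmin.
rewrite nl andbT; case: l nl lmin => [|l] nl lmin; first by rewrite vilenkin_M0.
by rewrite leqNgt; apply/negP => /lmin; rewrite ltnn.
Qed.

Definition local_mean K S x : R := mean N (fun t => (S t)%:R * majorant K (x - t)).

(** With [M l <= n < M l.+1] the kernel is bounded through [majorant l]. As [S] ignores the
    coordinates from [K] on, averaging over these gives [7 M_l / M_K], and [M_l / n <= 1]. *)
Lemma normc_convol_le K n g S (a : R) x : (K <= N)%N -> level K S -> 0 <= a ->
  (forall t, normc (g t) <= a * (S t)%:R) -> (0 < n)%N -> (M K <= n <= M N)%N ->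
  normc (convol n g x) <= 7 * Cker * a / MR K * local_mean K S x.
Proof.
move=> KN SK a0 gS n0 /andP[Kn nN].
have [l lN /andP[ln nl]] : exists2 l, (l <= N)%N & (M l <= n < M l.+1)%N.
  by apply: exists_vilenkin_M; rewrite n0.
have Kl : (K <= l)%N.
  rewrite leqNgt; apply/negP => /(leq_vilenkin_M m_ge2) /(leq_trans nl).
  by rewrite ltnNge Kn.
have nR : 0 < n%:R :> R by rewrite ltr0n.
apply: (le_trans (normc_avg _ _ _)).
apply: (@le_trans _ _ (mean N (fun t =>
    (a * Cker / n%:R) * ((S t)%:R * majorant l (x - t))))).
  apply: ler_mean => t; rewrite Normc.normcM.
  apply: (@le_trans _ _ (a * (S t)%:R * (Cker / n%:R * majorant l (x - t)))).
    by apply: ler_pM; rewrite ?normc_ge0 // ker_le // n0 ltnW.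
  by rewrite le_eqVlt; apply/orP; left; apply/eqP; ring.
rewrite /mean avgMl -/(mean N _) (mean_convol m_ge2 (K := K)) //; last 2 first.
- by apply: levelW (lN) (@majorant_level R m l).
- exact: (level_comp (fun b : bool => b%:R) SK).
apply: (@le_trans _ _ (a * Cker / n%:R * mean N (fun t =>
    (7 * (MR l / MR K)) * ((S t)%:R * majorant K (x - t))))).
  apply: ler_wpM2l; first by rewrite !mulr_ge0 ?invr_ge0.
  apply: ler_mean => t; rewrite mulrCA ler_wpM2l //.
  by apply: avg_majorant => //; rewrite Kl.
rewrite {1}/mean avgMl -/(mean N _) -/(local_mean K S x) [leLHS]mulrA.
have lm0 : 0 <= local_mean K S x.
  by apply: mean_ge0 => // t; rewrite mulr_ge0 ?majorant_ge0.
rewrite ler_wpM2r //.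
have -> : a * Cker / n%:R * (7 * (MR l / MR K)) =
  7 * Cker * a / MR K * (MR l / n%:R) by ring.
rewrite -[leRHS]mulr1 ler_wpM2l ?mulr_ge0 ?invr_ge0 //.
by rewrite ler_pdivrMr // mul1r ler_nat.
Qed.

Variables (w : nat -> R) (p Cw : R).
Hypothesis p01 : 0 < p <= 1.
Hypothesis w_gt0 : forall n, (0 < n)%N -> 0 < w n.
Hypothesis w_le : forall n n', (0 < n)%N -> (n <= n')%N -> w n <= w n'.
Hypothesis mean_w : forall K,
  (w (M K))^-1 `^ p * MR K `^ (1 - 2 * p) * mean K (fun x => majorant K x `^ p) <= Cw.

Definition atom_majorant K S x : R := (w (M K))^-1 / MR K * local_mean K S x.

Lemma local_mean_ge0 K S x : 0 <= local_mean K S x.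
Proof. by apply: mean_ge0 => // t; rewrite mulr_ge0 ?majorant_ge0. Qed.

Lemma atom_majorant_ge0 K S x : 0 <= atom_majorant K S x.
Proof.
rewrite mulr_ge0 ?local_mean_ge0 // divr_ge0 // invr_ge0 ltW // w_gt0 //.
exact: vilenkin_M_gt0.
Qed.

Lemma atom_majorant_level K S : (K <= N)%N -> level N (atom_majorant K S).
Proof.
move=> KN x y xy; rewrite /atom_majorant; congr (_ * _).
congr (mean N _); apply/funext => t; congr (_ * _).
by apply: (levelW KN (@majorant_level R m K)); apply: agreeD.
Qed.

(* For [n <= M_K] the cancellation of [g] at level [K] makes the convolution
   vanish; hence the weight may be frozen at [n = M_K]. *)
Lemma convol_atom_le K n g S (a : R) x : (K <= N)%N -> level K S -> 0 <= a ->
  (forall t, normc (g t) <= a * (S t)%:R) ->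
  K = 0 \/ avg (iota K (N - K)) g = (fun=> 0) -> (0 < n <= M N)%N ->
  normc (convol n g x) / w n <= 7 * Cker * a * atom_majorant K S x.
Proof.
move=> KN SK a0 gS K0g /andP[n0 nN].
have rhs0 : 0 <= 7 * Cker * a * atom_majorant K S x.
  by rewrite mulr_ge0 ?atom_majorant_ge0 // mulr_ge0 // mulr_ge0.
have [Kn|nK] := leqP (M K) n; last first.
  (* A piece starting at [K = 0] needs no cancellation: [M 0 = 1], so no admissible [n] lies
     below. *)
  case: K0g => [K0|g0]; first by move: nK; rewrite K0 vilenkin_M0 ltnNge n0.
  by rewrite (convol_vanish x KN (ltnW nK) g0) Normc.normc0 mul0r.
rewrite ler_pdivrMr ?w_gt0 //.
apply: (@le_trans _ _ (7 * Cker * a / MR K * local_mean K S x)).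
  by apply: normc_convol_le => //; rewrite Kn.
rewrite /atom_majorant.
have wK := w_gt0 (vilenkin_M_gt0 m_ge2 K); have lm0 := local_mean_ge0 K S x.
have -> : 7 * Cker * a * ((w (M K))^-1 / MR K * local_mean K S x) * w n =
  7 * Cker * a / MR K * local_mean K S x * (w n / w (M K)) by ring.
rewrite -[leLHS]mulr1 ler_wpM2l ?mulr_ge0 ?invr_ge0 //.
by rewrite ler_pdivlMr // mul1r w_le // vilenkin_M_gt0.
Qed.

(** At level [K] the power moves inside the local mean at the cost [M_K^(1-p)], which with the
    prefactor [M_K^(-p)] gives [M_K^(1-2p)]. Exchanging the averages and translation invariance then
    factor out the measure of [S]. *)
Lemma mean_atom_majorant K S : (K <= N)%N -> level K S ->
  mean N (fun x => atom_majorant K S x `^ p) <= Cw * mean N (fun x => (S x)%:R).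
Proof.
move=> KN SK; have /andP[p0 p1] := p01.
have MK0 : 0 < MR K by exact: vilenkin_MR_gt0.
have wK := w_gt0 (vilenkin_M_gt0 m_ge2 K).
have SRK : level K (fun t => (S t)%:R : R).
  exact: (level_comp (fun b : bool => b%:R) SK).
have pw (x : V) : atom_majorant K S x `^ p <=
    (w (M K))^-1 `^ p * MR K `^ (1 - 2 * p) *
      mean K (fun t => (S t)%:R * majorant K (x - t) `^ p).
  have wi0 : 0 <= (w (M K))^-1 by rewrite invr_ge0 ltW.
  have Mi0 : 0 <= (MR K)^-1 by rewrite invr_ge0.
  have lm0 := local_mean_ge0 K S x.
  rewrite /atom_majorant powRM ?mulr_ge0 // powRM //.
  rewrite -!mulrA ler_wpM2l ?powR_ge0 //.
  have -> : 1 - 2 * p = - p + (1 - p) by ring.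
  rewrite powRD ?vilenkin_MR_neq0 ?implybT // -powR_inv1 // -powRrM mulN1r -mulrA.
  rewrite ler_wpM2l ?powR_ge0 //.
  rewrite /local_mean (mean_levelE m_ge2 KN); last first.
    by apply: level_comp2 => //; apply: level_reflect; exact: majorant_level.
  apply: (le_trans (mean_powR_le _ _ p01 _)) => // [t|].
    by rewrite mulr_ge0 ?majorant_ge0.
  rewrite ler_wpM2l ?powR_ge0 // ler_mean // => t.
  rewrite powRM ?majorant_ge0 //; case: (S t); first by rewrite powR1.
  by rewrite powR0 ?mul0r // gt_eqF.
apply: (le_trans (ler_mean _ pw)); rewrite /mean avgMl avg_exchange -/(mean K _).
rewrite (_ : mean K _ = mean K (fun x => majorant K x `^ p) * mean N (fun x => (S x)%:R)).
  rewrite mulrA ler_wpM2r ?mean_w //.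
  by apply: mean_ge0.
rewrite (mean_levelE m_ge2 KN SRK).
have majK : level N (fun x => majorant K x `^ p).
  by apply: levelW (KN) _; apply: (level_comp (fun u => u `^ p)); exact: majorant_level.
transitivity (mean K (fun t =>
    mean K (fun x => majorant K x `^ p) * (S t)%:R)); last first.
  by rewrite /mean avgMl.
congr (mean K _); apply/funext => t; rewrite avgMl mulrC; congr (_ * _).
rewrite -/(mean N _) (@mean_shift m R N (fun x => majorant K x `^ p) (- t)) //.
rewrite (mean_levelE m_ge2 KN) //.
by apply: (level_comp (fun u => u `^ p)); exact: majorant_level.
Qed.

End convolution.

(** * Stopping times *)

Section stopping.
Variables (R : realType) (m : nat -> nat).
Hypothesis m_ge2 : forall k, (2 <= m k)%N.
Local Notation V := (vilenkin m).
Local Notation MR n := ((@vilenkin_M m n)%:R : R).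
Local Notation C := R[i].
Local Notation normc := (@Normc.normc R).
Implicit Types (x y : V) (n k K N l : nat) (t u : R).

Variable f : nat -> V -> C.
Hypothesis f_level : forall n, level n (f n).
Hypothesis f_martingale : forall n, coord_avg n (f n.+1) = f n.

(* The value of the martingale at time [j.+1] is tested on the whole cylinder of
   rank [j] of [x], so that [exceeds t n.+1] only depends on the first [n]
   coordinates: a predictable version of [max_(0 < j <= n) |f j| > t]. *)
Definition exceeds t n x : bool :=
  `[< exists j y, [/\ (j < n)%N, agree j x y & t < normc (f j.+1 y)] >].

Definition first_exceeds t n x : bool := exceeds t n.+1 x && ~~ exceeds t n x.

Definition stopped t N x : C :=
  f 0 x + \sum_(n < N) (~~ exceeds t n.+1 x)%:R * (f n.+1 x - f n x).

Lemma exceeds0 t x : exceeds t 0 x = false.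
Proof. by apply/negbTE/asboolPn => -[j [y []]]. Qed.

Lemma exceeds_level t n : level n (exceeds t n.+1).
Proof.
move=> x y xy; apply/asboolP/asboolP => -[j [z [jn jz tz]]]; exists j, z; split => //.
  by apply: agree_trans jz; apply: agree_sym; apply: agreeW xy.
by apply: agree_trans jz; apply: agreeW xy.
Qed.

Lemma exceedsW t n n' x : (n <= n')%N -> exceeds t n x -> exceeds t n' x.
Proof.
move=> nn' /asboolP[j [y [jn xy ty]]]; apply/asboolP; exists j, y; split => //.
exact: leq_trans nn'.
Qed.

Lemma exceeds_anti t t' n x : t <= t' -> exceeds t' n x -> exceeds t n x.
Proof.
move=> tt' /asboolP[j [y [jn xy ty]]]; apply/asboolP; exists j, y; split => //.
exact: le_lt_trans ty.
Qed.

Lemma exceeds_levelW t n n' : (n <= n'.+1)%N -> level n' (exceeds t n).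
Proof.
case: n => [_ x y _|n nn']; first by rewrite !exceeds0.
by apply: levelW (@exceeds_level t n).
Qed.

Lemma first_exceeds_level t n : level n (first_exceeds t n).
Proof.
move=> x y xy; rewrite /first_exceeds (@exceeds_levelW t _ n _ _ _ xy) //.
by rewrite (@exceeds_levelW t _ n _ _ _ xy).
Qed.

Lemma normc_le_nexceeds t n x : ~~ exceeds t n.+1 x -> normc (f n.+1 x) <= t.
Proof.
by move=> /asboolPn h; rewrite leNgt; apply/negP => tx; apply: h; exists n, x.
Qed.

Lemma stoppedS t N x : stopped t N.+1 x =
  stopped t N x + (~~ exceeds t N.+1 x)%:R * (f N.+1 x - f N x).
Proof. by rewrite /stopped big_ord_recr addrA. Qed.

Lemma stopped_id t N x : ~~ exceeds t N x -> stopped t N x = f N x.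
Proof.
elim: N => [|N IH] nex; first by rewrite /stopped big_ord0 addr0.
rewrite stoppedS nex mul1r IH; first by rewrite addrC subrK.
by apply: contra nex; exact: exceedsW.
Qed.

(** Predictability excludes an overshoot: the increment to time [N.+1] is added only if the new
    value is known not to exceed [t]. *)
Lemma normc_stopped_le t N x : normc (f 0 x) <= t -> normc (stopped t N x) <= t.
Proof.
move=> f0; elim: N => [|N IH]; first by rewrite /stopped big_ord0 addr0.
have [ex|nex] := boolP (exceeds t N.+1 x).
  by rewrite stoppedS ex mul0r addr0.
by rewrite stopped_id // normc_le_nexceeds.
Qed.

Lemma sum_first_exceeds (F : pzRingType) t N x :
  \sum_(K < N) (first_exceeds t K x)%:R = (exceeds t N x)%:R :> F.
Proof.
elim: N => [|N IH]; first by rewrite big_ord0 exceeds0.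
rewrite big_ord_recr /= IH /first_exceeds.
case: (boolP (exceeds t N x)) => ex; first by rewrite (exceedsW _ ex) //= addr0.
by rewrite andbT add0r.
Qed.

Definition layer t t' N x : C := stopped t' N x - stopped t N x.

(** Where [t] is never exceeded neither process has stopped, so the layer is zero; elsewhere exactly
    one [K] is the first time. *)
Lemma layerE t t' N x : t <= t' ->
  layer t t' N x = \sum_(K < N) layer t t' N x * (first_exceeds t K x)%:R.
Proof.
move=> tt'; rewrite -mulr_sumr sum_first_exceeds.
have [ex|nex] := boolP (exceeds t N x); first by rewrite mulr1.
rewrite mulr0 /layer !stopped_id ?subrr //.
by apply: contra nex; exact: exceeds_anti.
Qed.

Lemma avg_martingale K N : (K <= N)%N -> avg (iota K (N - K)) (f N) = f K.
Proof.
move=> /subnKC <-; rewrite addKn; elim: (N - K)%N => [|d IH]; first by rewrite addn0.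
by rewrite -addn1 iotaD avg_cat addn1 addnS /= f_martingale.
Qed.

(** On the event that [K] is the first time, increments before [K] occur in both stopped processes
    and cancel. Later ones carry a coefficient known at their own time [n >= K], so they average to
    zero. *)
Lemma avg_layer t t' K N : t <= t' -> (K <= N)%N ->
  avg (iota K (N - K)) (fun x => layer t t' N x * (first_exceeds t K x)%:R) = fun=> 0.
Proof.
move=> tt' KN.
pose c n x : C := ((~~ exceeds t' n.+1 x)%:R - (~~ exceeds t n.+1 x)%:R) *
  (first_exceeds t K x)%:R.
have -> : (fun x => layer t t' N x * (first_exceeds t K x)%:R) =
    fun x => \sum_(n < N) (f n.+1 x - f n x) * c n x.
  apply/funext => x; rewrite /layer /stopped opprD addrACA subrr add0r -sumrB mulr_suml.
  by apply: eq_bigr => n _; rewrite /c; ring.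
rewrite avg_sum; apply/funext => x; apply: big1 => n _.
have [nK|Kn] := ltnP n K.
  rewrite (_ : (fun x => _) = fun=> 0) ?avg_cst //; apply/funext => y.
  suff -> : c n y = 0 by rewrite mulr0.
  rewrite /c /first_exceeds; case: (boolP (exceeds t K y)) => ex.
    by rewrite andbF mulr0.
  have nex : ~~ exceeds t n.+1 y by apply: contra ex; exact: exceedsW.
  have nex' : ~~ exceeds t' n.+1 y by apply: contra nex; exact: exceeds_anti.
  by rewrite nex nex' subrr mul0r.
have -> : iota K (N - K) = iota K (n - K) ++ iota n (N - n).
  have -> : (N - K = (n - K) + (N - n))%N.
    by rewrite addnC addnBA // subnK // ltnW.
  by rewrite iotaD subnKC.
have cn : level n (c n).
  move=> y z yz; rewrite /c (@exceeds_level t n _ _ yz) (@exceeds_level t' n _ _ yz).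
  by rewrite (levelW Kn (@first_exceeds_level t K) yz).
rewrite avg_cat (avgM_level _ _ cn) // avgB.
rewrite (avg_level_id m_ge2 _ (@f_level n)) //.
have -> : avg (iota n (N - n)) (f n.+1) = f n.
  rewrite -(subnSK (ltn_ord n)) /= (avg_level_id m_ge2 _ (@f_level n.+1)) //.
rewrite (_ : (fun x => _) = fun=> 0) ?avg_cst //.
by apply/funext => y; rewrite subrr mul0r.
Qed.

Definition running_max N x : R := \big[Num.max/0]_(j < N.+1) normc (f j x).

Lemma running_max_ge N j x : (j <= N)%N -> normc (f j x) <= running_max N x.
Proof.
move=> jN; have jN' : (j < N.+1)%N by [].
exact: (le_bigmax _ (fun j : 'I_N.+1 => normc (f j x)) (Ordinal jN')).
Qed.

Lemma running_max_ge0 N x : 0 <= running_max N x.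
Proof. exact: le_trans (normc_ge0 _) (running_max_ge x (leq0n N)). Qed.

Lemma running_max_level N : level N (running_max N).
Proof.
move=> x y xy; apply: eq_bigr => j _; rewrite (levelW _ (@f_level j) xy) //.
by rewrite -ltnS.
Qed.

(** The price of predictability: a cylinder of rank [K] stopped at time [K] contains a child where
    [f K.+1] really exceeds [t], and this child fills at least the fraction [1 / B] of it. *)
Lemma mean_exceeds_le B t N : (forall k, (m k <= B)%N) ->
  mean N (fun x => (exceeds t N x)%:R : R) <=
  B%:R * mean N (fun x => (t < running_max N x)%R%:R).
Proof.
move=> mB.
pose u K x : R := (first_exceeds t K x && (t < normc (f K.+1 x))%R)%:R.
have firstE K : (K < N)%N ->
    mean N (fun x => (first_exceeds t K x)%:R : R) <= B%:R * mean N (u K).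
  move=> KN.
  have uK : level K.+1 (u K).
    move=> x y xy; rewrite /u (@f_level K.+1 _ _ xy).
    by rewrite (levelW (leqnSn K) (@first_exceeds_level t K) xy).
  have -> : mean N (u K) = mean N (coord_avg K (u K)).
    rewrite (mean_levelE m_ge2 KN uK) (mean_levelE m_ge2 (ltnW KN)); last first.
      exact: coord_avg_levelS.
    by rewrite {1}/mean -addn1 iotaD avg_cat.
  apply: (@le_trans _ _ (mean N (fun x => (m K)%:R * coord_avg K (u K) x))).
    apply: ler_mean => x; rewrite /coord_avg mulVKf ?mR_neq0 //.
    have [fx|_] := boolP (first_exceeds t K x); last by rewrite sumr_ge0.
    have /andP[/asboolP[j [y [jK xy ty]]] nex] := fx.
    (* A witness at a time before [K] would already make [exceeds t K x] true. *)
    have jE : j = K.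
      apply/eqP; rewrite eqn_leq -ltnS jK /= leqNgt; apply: contra nex => jK'.
      by apply/asboolP; exists j, y.
    (* This translate of [x] enters the rank [K.+1] cylinder of the witness [y], hence counts one
       full unit. *)
    subst j; rewrite (bigD1 (crd y K - crd x K)) //= -[leLHS]addr0 lerD ?sumr_ge0 //.
    rewrite /u (level_delta (@first_exceeds_level t K)) // fx /=.
    by rewrite (@f_level K.+1 _ y) ?ty //; apply: agreeS.
  rewrite {1}/mean avgMl -/(mean N _) ler_wpM2r ?ler_nat // mean_ge0 // => x.
  by apply: (@avg_ge0 R m m_ge2 [:: K] (u K)) => y.
rewrite (_ : (fun x => _) = fun x => \sum_(K < N) (first_exceeds t K x)%:R); last first.
  by apply/funext => x; rewrite sum_first_exceeds.
rewrite /mean avg_sum; apply: (@le_trans _ _ (\sum_(K < N) B%:R * mean N (u K))).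
  by apply: ler_sum => K _; exact: firstE.
have -> : \sum_(K < N) B%:R * mean N (u K) = B%:R * mean N (fun x => \sum_(K < N) u K x).
  by rewrite /mean avg_sum mulr_sumr.
rewrite ler_wpM2l //.
apply: ler_avg => x.
have [tm|ntm] := boolP (t < running_max N x).
  apply: (@le_trans _ _ (\sum_(K < N) (first_exceeds t K x)%:R)).
    apply: ler_sum => K _; rewrite /u; case: first_exceeds => //=.
    by case: (t < _).
  by rewrite sum_first_exceeds; case: exceeds.
rewrite big1 // => K _; rewrite /u; case: first_exceeds => //=.
rewrite ltNge (le_trans (running_max_ge x (ltn_ord K))) //.
by rewrite leNgt.
Qed.

Lemma exists_dyadic_bound (c : R) N : 0 < c ->
  exists L, forall x, ~~ exceeds (2 ^+ L * c) N x.
Proof.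
move=> c0; pose T := \sum_(j < N.+1) MR j * mean j (fun x => normc (f j x)).
have fT j x : (j <= N)%N -> normc (f j x) <= T.
  move=> jN; have jN' : (j < N.+1)%N by [].
  rewrite /T (bigD1 (Ordinal jN')) //= -[leLHS]addr0 lerD ?sumr_ge0 //.
    apply: (ler_level_mean m_ge2) => [|y]; last exact: normc_ge0.
    exact: level_comp (@f_level j).
  by move=> i _; rewrite mulr_ge0 // mean_ge0 // => y; exact: normc_ge0.
have T0 : 0 <= T by apply: le_trans (fT 0 0 _); rewrite ?normc_ge0.
have [L TL] : exists L, T / c <= 2 ^+ L.
  exists (Num.bound (T / c)); apply: (@le_trans _ _ (Num.bound (T / c))%:R).
    by apply: ltW; apply: archi_boundP; rewrite divr_ge0 // ltW.
  by rewrite -natrX ler_nat ltnW // ltn_expl.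
exists L => x; apply/asboolPn => -[j [y [jN _]]]; rewrite ltNge => /negP; apply.
by apply: (le_trans (fT j.+1 y jN)); rewrite -ler_pdivrMr.
Qed.

(** A discrete layer-cake formula: the heights below [u] form a geometric progression whose largest
    term is less than [u]. *)
Lemma sum_dyadic_layer_le (p c : R) L u : 0 < p -> 0 < c -> 0 <= u ->
  \sum_(k < L) (2 ^+ k * c) `^ p * (2 ^+ k * c < u)%R%:R <=
  2 `^ p / (2 `^ p - 1) * u `^ p.
Proof.
move=> p0 c0 u0.
have rho1 := lt1_powR2 p0.
have D0 : 0 <= 2 `^ p / (2 `^ p - 1) by rewrite divr_ge0 ?powR_ge0 // subr_ge0 ltW.
elim: L => [|L IH]; first by rewrite big_ord0 mulr_ge0 ?powR_ge0.
have [cu|cu] := boolP (2 ^+ L * c < u); last first.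
  by rewrite big_ord_recr /= (negPf cu) mulr0 addr0.
apply: (@le_trans _ _ (\sum_(k < L.+1) (2 ^+ k * c) `^ p)).
  by apply: ler_sum => k _; case: (_ < u); rewrite ?mulr1 ?mulr0 ?powR_ge0.
apply: (@le_trans _ _ (2 `^ p / (2 `^ p - 1) * (2 ^+ L * c) `^ p)).
  apply: (@sum_geometric_le R _ (fun k => (2 ^+ k * c) `^ p)) => // [k|].
    by rewrite exprS -mulrA [leRHS]powRM ?mulr_ge0 ?exprn_ge0 // ltW.
  exact: powR_ge0.
have hc : 0 <= 2 ^+ L * c by rewrite mulr_ge0 ?exprn_ge0 // ltW.
by rewrite ler_wpM2l // ge0_ler_powR ?nnegrE // ltW.
Qed.

End stopping.

(** * The maximal inequality for indices up to [M N] *)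

Section finite_maximal_inequality.
Variables (R : realType) (m : nat -> nat).
Hypothesis m_ge2 : forall k, (2 <= m k)%N.
Local Notation V := (vilenkin m).
Local Notation M := (@vilenkin_M m).
Local Notation MR n := ((@vilenkin_M m n)%:R : R).
Local Notation C := R[i].
Local Notation normc := (@Normc.normc R).
Local Notation majorant := (@majorant R m).

Variables (ker : nat -> V -> C) (Cker : R).
Hypothesis Cker_ge0 : 0 <= Cker.
Hypothesis ker_level : forall K n, (n <= M K)%N -> level K (ker n).
Hypothesis ker_le : forall l n x, (0 < n <= M l.+1)%N ->
  normc (ker n x) <= Cker / n%:R * majorant l x.

Variables (w : nat -> R) (p Cw : R).
Hypothesis p01 : 0 < p <= 1.
Hypothesis w_gt0 : forall n, (0 < n)%N -> 0 < w n.
Hypothesis w_le : forall n n', (0 < n)%N -> (n <= n')%N -> w n <= w n'.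
Hypothesis mean_w : forall K,
  (w (M K))^-1 `^ p * MR K `^ (1 - 2 * p) * mean K (fun x => majorant K x `^ p) <= Cw.

Variable B : nat.
Hypothesis m_le : forall k, (m k <= B)%N.

Lemma Cw_ge0 : 0 <= Cw.
Proof.
apply: le_trans (mean_w 0); apply: mulr_ge0.
  by apply: mulr_ge0; exact: powR_ge0.
by apply: mean_ge0 => // x; exact: powR_ge0.
Qed.

Section decomposition.
Variables (f : nat -> V -> C) (N : nat) (c : R).
Hypothesis f_level : forall n, level n (f n).
Hypothesis f_martingale : forall n, coord_avg n (f n.+1) = f n.
Hypothesis c_gt0 : 0 < c.
Hypothesis f0_le : forall x, normc (f 0 x) <= c.

Local Notation atom := (atom_majorant N w).
Local Notation height k := (2 ^+ k * c).
Local Notation first k K := (first_exceeds f (height k) K).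

(** The first summand belongs to the martingale stopped at height [c], treated as one piece on the
    whole group starting at time zero; the others belong to the layers, cut by their starting
    time. *)
Definition maximal_majorant L x : R := 7 * Cker * (c * atom 0 (fun=> true) x +
  \sum_(k < L) \sum_(K < N) 3 * height k * atom K (first k K) x).

Lemma height_gt0 k : 0 < height k.
Proof. by rewrite mulr_gt0 // exprn_gt0. Qed.

Lemma c_le_height k : c <= height k.
Proof.
have c0 : 0 <= c by exact: ltW.
by rewrite -[leLHS]mul1r ler_wpM2r // exprn_ege1 // ler1n.
Qed.

(** The two stopped martingales are bounded by [2 * height k] and [height k]. *)
Lemma normc_layer_le k x :
  normc (layer f (height k) (height k.+1) N x) <= 3 * height k.
Proof.
have h0 t : c <= t -> normc (stopped f t N x) <= t.
  by move=> ct; apply: normc_stopped_le; apply: le_trans ct.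
apply: (le_trans (ler_normcB _ _)).
have := h0 _ (c_le_height k); have := h0 _ (c_le_height k.+1).
rewrite exprS -mulrA; set u := height k; lra.
Qed.

Lemma convol_le_maximal_majorant L n x :
  (forall x, ~~ exceeds f (height L) N x) -> (0 < n <= M N)%N ->
  normc (convol ker N n (f N) x) / w n <= maximal_majorant L x.
Proof.
move=> Lbig nN; have /andP[n0 _] := nN; have wn := w_gt0 n0.
have heightS k : height k <= height k.+1.
  by rewrite exprS -mulrA; have := height_gt0 k; lra.
pose piece k K y : C := layer f (height k) (height k.+1) N y * (first k K y)%:R.
have fE : f N = fun y => stopped f c N y + \sum_(k < L) \sum_(K < N) piece k K y.
  apply/funext => y; rewrite -(stopped_id (Lbig y)).
  transitivity (stopped f c N y + \sum_(k < L) layer f (height k) (height k.+1) N y).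
    (* The height [height L] is never exceeded, so stopping there returns [f N], and the layers
       telescope down to height [c]. *)
    have := telescope_sumr (fun k => stopped f (height k) N y) (leq0n L).
    by rewrite expr0 mul1r big_mkord => ->; rewrite addrC subrK.
  congr (_ + _); apply: eq_bigr => k _; exact: layerE.
rewrite fE convolD convol_sum.
under eq_bigr do rewrite convol_sum.
rewrite /maximal_majorant mulrDr.
apply: (@le_trans _ _ (normc (convol ker N n (stopped f c N) x) / w n +
   \sum_(k < L) \sum_(K < N) normc (convol ker N n (piece k K) x) / w n)).
  have -> : \sum_(k < L) \sum_(K < N) normc (convol ker N n (piece k K) x) / w n =
      (\sum_(k < L) \sum_(K < N) normc (convol ker N n (piece k K) x)) / w n.
    by rewrite mulr_suml; apply: eq_bigr => k _; rewrite mulr_suml.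
  rewrite -mulrDl.
  have wi0 : 0 <= (w n)^-1 by rewrite invr_ge0 ltW.
  rewrite ler_wpM2r //; apply: (le_trans (ler_normcD _ _)).
  rewrite lerD2l; apply: (le_trans (normc_sum _ _ _)); apply: ler_sum => k _.
  exact: normc_sum.
apply: lerD.
  rewrite mulrA; apply: (convol_atom_le m_ge2 Cker_ge0 ker_level ker_le w_gt0 w_le) => //.
  - exact: ltW.
  - by move=> t; rewrite mulr1 normc_stopped_le.
  - by left.
rewrite mulr_sumr; apply: ler_sum => k _; rewrite mulr_sumr; apply: ler_sum => K _.
have hk := height_gt0 k.
rewrite mulrA; apply: (convol_atom_le m_ge2 Cker_ge0 ker_level ker_le w_gt0 w_le) => //.
- exact: ltnW.
- exact: first_exceeds_level.
- by rewrite mulr_ge0 // ltW.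
- move=> t; rewrite /piece Normc.normcM normc_nat ler_wpM2r //.
  exact: normc_layer_le.
- by right; apply: avg_layer => //; exact: ltnW.
Qed.

Lemma maximal_majorant_ge0 L x : 0 <= maximal_majorant L x.
Proof.
rewrite mulr_ge0 ?mulr_ge0 // addr_ge0 //.
  by rewrite mulr_ge0 ?atom_majorant_ge0 // ltW.
apply: sumr_ge0 => k _; apply: sumr_ge0 => K _.
by rewrite mulr_ge0 ?atom_majorant_ge0 // mulr_ge0 // ltW // height_gt0.
Qed.

Lemma maximal_majorant_level L : level N (maximal_majorant L).
Proof.
move=> x y xy; rewrite /maximal_majorant; congr (_ * (_ * _ + _)).
  by rewrite (atom_majorant_level _ _ (leq0n N) xy).
apply: eq_bigr => k _; apply: eq_bigr => K _; congr (_ * _).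
by rewrite (atom_majorant_level _ _ (ltnW (ltn_ord K)) xy).
Qed.

(** Summing over [K] turns the first-time sets into [exceeds]; [mean_exceeds_le] passes to the
    running maximum, and the sum over heights is [sum_dyadic_layer_le]. *)
Lemma mean_maximal_majorant L :
  mean N (fun x => maximal_majorant L x `^ p) <=
  (7 * Cker) `^ p * Cw * (1 + 3 `^ p * B%:R * (2 `^ p / (2 `^ p - 1))) *
   (c `^ p + mean N (fun x => running_max f N x `^ p)).
Proof.
have /andP[p0 p1] := p01.
have at0 := atom_majorant_ge0 m_ge2 N w_gt0.
have Cw0 := Cw_ge0.
have pw x : maximal_majorant L x `^ p <= (7 * Cker) `^ p *
    (c `^ p * atom 0 (fun=> true) x `^ p +
     \sum_(k < L) \sum_(K < N) (3 * height k) `^ p * atom K (first k K) x `^ p).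
  have a0 : 0 <= c * atom 0 (fun=> true) x by rewrite mulr_ge0 ?at0 // ltW.
  have ak k K : 0 <= 3 * height k * atom K (first k K) x.
    by rewrite mulr_ge0 ?at0 // mulr_ge0 // ltW // height_gt0.
  have ask k : 0 <= \sum_(K < N) 3 * height k * atom K (first k K) x.
    by apply: sumr_ge0.
  have k0 : 0 <= 7 * Cker by rewrite mulr_ge0.
  rewrite /maximal_majorant (powRM _ k0); last by rewrite addr_ge0 // sumr_ge0.
  rewrite ler_wpM2l ?powR_ge0 //.
  apply: (le_trans (powR_add_le _ _ p01)); rewrite ?sumr_ge0 //.
  have c0 : 0 <= c by exact: ltW.
  rewrite powRM ?at0 // lerD2l.
  apply: (le_trans (powR_sum_le _ p01 _)) => //; apply: ler_sum => k _.
  apply: (le_trans (powR_sum_le _ p01 _)) => //; apply: ler_sum => K _.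
  by rewrite powRM ?at0 // mulr_ge0 // ltW // height_gt0.
apply: (le_trans (ler_mean _ pw)); rewrite /mean avgMl -!mulrA.
rewrite ler_wpM2l ?powR_ge0 // avgD avgMl avg_sum.
have atE K S := @mean_atom_majorant R m m_ge2 N w p Cw p01 w_gt0 mean_w K S.
set FP := avg (iota 0 N) (fun x : V => running_max f N x `^ p) 0.
have FP0 : 0 <= FP by apply: avg_ge0 => // x; exact: powR_ge0.
have cp0 : 0 <= c `^ p := powR_ge0 _ _.
have e0 : c `^ p * avg (iota 0 N) (fun x : V => atom 0 (fun=> true) x `^ p) 0 <=
    Cw * c `^ p.
  rewrite [leLHS]mulrC ler_wpM2r //.
  by apply: (le_trans (atE 0 (fun=> true) _ _)) => //; rewrite /mean avg_cst // mulr1.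
set D := 2 `^ p / (2 `^ p - 1).
have rho1 := lt1_powR2 p0.
have D0 : 0 <= D by rewrite divr_ge0 ?powR_ge0 // subr_ge0 ltW.
have e1 : \sum_(k < L) avg (iota 0 N) (fun x =>
     \sum_(K < N) (3 * height k) `^ p * atom K (first k K) x `^ p) 0 <=
    Cw * (3 `^ p * B%:R) * (D * FP).
  have h1 k : avg (iota 0 N) (fun x =>
     \sum_(K < N) (3 * height k) `^ p * atom K (first k K) x `^ p) 0 <=
     Cw * (3 `^ p * B%:R) *
      (height k `^ p * mean N (fun x => (height k < running_max f N x)%R%:R)).
    rewrite avg_sum.
    apply: (@le_trans _ _ (\sum_(K < N) (3 * height k) `^ p *
        (Cw * mean N (fun x => (first k K x)%:R)))).
      apply: ler_sum => K _; rewrite avgMl ler_wpM2l ?powR_ge0 //.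
      apply: atE; last exact: first_exceeds_level.
      exact: ltnW.
    rewrite -mulr_sumr -mulr_sumr.
    have -> : \sum_(K < N) mean N (fun x => (first k K x)%:R) =
        mean N (fun x => (exceeds f (height k) N x)%:R) :> R.
      transitivity (mean N (fun x => \sum_(K < N) (first k K x)%:R : R)).
        by rewrite /mean avg_sum.
      by congr (avg _ _ _); apply/funext => x; rewrite sum_first_exceeds.
    have := mean_exceeds_le m_ge2 f_level (height k) N m_le.
    move=> /(ler_wpM2l (mulr_ge0 (powR_ge0 (3 * height k) p) Cw0)).
    rewrite powRM ?(ltW (height_gt0 k)) // => h.
    apply: (le_trans _ (le_trans h _)); rewrite le_eqVlt; apply/orP; left;
      apply/eqP; ring.
  apply: (le_trans (ler_sum _ (fun k _ => h1 (nat_of_ord k)))).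
  rewrite -mulr_sumr ler_wpM2l ?mulr_ge0 ?powR_ge0 //.
  apply: (@le_trans _ _ (avg (iota 0 N) (fun x =>
      \sum_(k < L) height k `^ p * (height k < running_max f N x)%R%:R) 0)).
    by rewrite avg_sum; apply: ler_sum => k _; rewrite avgMl.
  have -> : D * FP = avg (iota 0 N) (fun x => D * running_max f N x `^ p) 0.
    by rewrite avgMl.
  apply: ler_avg => x; apply: sum_dyadic_layer_le => //; exact: running_max_ge0.
apply: (le_trans (lerD e0 e1)).
have E0 : 0 <= 3 `^ p * B%:R * D.
  by apply: mulr_ge0 => //; apply: mulr_ge0 => //; exact: powR_ge0.
have -> : Cw * (3 `^ p * B%:R) * (D * FP) = Cw * (3 `^ p * B%:R * D * FP) by ring.
rewrite -mulrDr ler_wpM2l // -/D [3 `^ p * (_ * D)]mulrA.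
have := mulr_ge0 E0 cp0; move: (3 `^ p * B%:R * D) E0 => E E0; lra.
Qed.

End decomposition.

Lemma finite_maximal_inequality : exists2 A : R, 0 <= A &
  forall (f : nat -> V -> C) N (c : R),
  (forall n, level n (f n)) -> (forall n, coord_avg n (f n.+1) = f n) ->
  0 < c -> (forall x, normc (f 0 x) <= c) ->
  exists U : V -> R, [/\ level N U, forall x, 0 <= U x,
    forall n x, (0 < n <= M N)%N -> normc (convol ker N n (f N) x) / w n <= U x &
    mean N (fun x => U x `^ p) <=
      A * (c `^ p + mean N (fun x => running_max f N x `^ p))].
Proof.
exists ((7 * Cker) `^ p * Cw * (1 + 3 `^ p * B%:R * (2 `^ p / (2 `^ p - 1)))).
  have /andP[p0 _] := p01; have rho1 := lt1_powR2 p0.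
  have Cw0 := Cw_ge0.
  rewrite mulr_ge0 ?mulr_ge0 ?powR_ge0 // addr_ge0 // !mulr_ge0 ?powR_ge0 //.
  by rewrite invr_ge0 subr_ge0 ltW.
move=> f N c fl fm c0 f0.
have [L LP] := exists_dyadic_bound m_ge2 fl N c0.
exists (maximal_majorant f N c L); split.
- exact: maximal_majorant_level.
- by move=> x; exact: maximal_majorant_ge0.
- by move=> n x nN; exact: convol_le_maximal_majorant.
- exact: mean_maximal_majorant.
Qed.

End finite_maximal_inequality.

(** * Haar measure and Fourier coefficients *)

Section haar_measure.
Variables (R : realType) (m : nat -> nat).
Hypothesis m_ge2 : forall k, (2 <= m k)%N.
Variable mu : probability (vilenkin m) R.
Hypothesis mu_haar : normalized_haar mu.
Local Notation V := (vilenkin m).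
Local Notation MR n := ((@vilenkin_M m n)%:R : R).
Implicit Types (x y : V) (n k K N l : nat).

Lemma cylinder_agree n x y : cylinder n x y <-> agree n y x.
Proof. by []. Qed.

Lemma open_crd k (A : set 'Z_(m k)) : open [set x : V | A (crd x k)].
Proof.
have cont := @proj_continuous nat (fun k => discrete_topology 'Z_(m k)) k.
have opA : @open (prod_topology (fun k => discrete_topology 'Z_(m k)))
    (proj k @^-1` (A : set (discrete_topology 'Z_(m k)))).
  by apply: open_comp; [move=> x _; exact: cont|exact: discrete_open].
exact: opA.
Qed.

Lemma open_cylinder n x : open (cylinder n x).
Proof.
elim: n => [|n IH].
  rewrite (_ : cylinder 0 x = setT); first exact: openT.
  by apply/seteqP; split => // y _ k.
rewrite (_ : cylinder n.+1 x = cylinder n x `&` [set y : V | [set crd x n] (crd y n)]).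
  by apply: openI => //; exact: open_crd.
apply/seteqP; split => [y yx|y [yx yn] k].
  split; last exact: yx.
  by move=> k kn; apply: yx; exact: ltnW.
by rewrite ltnS leq_eqVlt => /orP[/eqP ->|kn]; [exact: yn|exact: yx].
Qed.

Lemma open_measurable_vilenkin (A : set V) : open A -> measurable A.
Proof. by move=> oA; apply: sub_sigma_algebra. Qed.

Lemma measurable_cylinder n x : measurable (cylinder n x).
Proof. by apply: open_measurable_vilenkin; exact: open_cylinder. Qed.

Lemma measurable_level (A : set V) n : level n A -> measurable A.
Proof.
move=> An; rewrite (_ : A = \bigcup_(x in A) cylinder n x).
  by apply: open_measurable_vilenkin; apply: bigcup_open => x _; exact: open_cylinder.
apply/seteqP; split => [x Ax|y [x Ax] /(An y x) ->//].
by exists x.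
Qed.

Lemma measurable_fun_level (D : set V) (g : V -> \bar R) n :
  level n g -> measurable_fun D g.
Proof.
move=> gn mD Y mY; apply: measurableI => //; apply: (measurable_level (n := n)).
by move=> x y xy; rewrite /preimage /= (gn _ _ xy).
Qed.

Lemma cylinder_split n x :
  cylinder n x = \big[setU/set0]_(a : 'Z_(m n)) cylinder n.+1 (x + delta a).
Proof.
rewrite -bigcup_seq; apply/seteqP; split => [y yx|y [a _ ya]] /=.
  exists (crd y n - crd x n); first by rewrite /= mem_index_enum.
  by apply/cylinder_agree; apply: agree_sym; apply: agreeS; exact: agree_sym.
apply/cylinder_agree; apply: (@agree_trans _ _ _ (x + delta a)).
  by apply: (agreeW (leqnSn n)).
exact: agree_delta.
Qed.

Lemma trivIset_cylinder n x (D : set 'Z_(m n)) :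
  trivIset D (fun a => cylinder n.+1 (x + delta a)).
Proof.
move=> a b _ _ [y [ya yb]].
have : crd (x + delta a) n = crd (x + delta b) n.
  by rewrite -[LHS](ya n (ltnSn n)) -[RHS](yb n (ltnSn n)).
by rewrite !crdD !crd_delta => /addrI.
Qed.

Lemma measure_cylinder0 n x : mu (cylinder n x) = mu (cylinder n 0).
Proof.
rewrite -(mu_haar x (measurable_cylinder n 0)); congr (mu _).
apply/seteqP; split => [y yx|_ [y y0 <-] k kn].
  exists (y - x); last by rewrite addrC subrK.
  by move=> j jn; rewrite -[LHS]/(crd y j - crd x j) [crd y j](yx j jn) subrr.
by rewrite -[LHS]/(crd x k + crd y k) [crd y k]y0 // addr0.
Qed.

(** The [m n] children of a cylinder are translates of each other, so invariance gives them equal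
    shares. *)
Lemma measure_cylinder n x : mu (cylinder n x) = ((MR n)^-1)%:E.
Proof.
elim: n x => [|n IH] x.
  rewrite (_ : cylinder 0 x = setT) ?probability_setT ?vilenkin_M0 ?invr1 //.
  by apply/seteqP; split => // y _ k.
have sumE : mu (cylinder n 0) =
    (\sum_(a : 'Z_(m n)) mu (cylinder n.+1 (0 + delta a)%R))%E.
  rewrite [in LHS]cylinder_split measure_semi_additive_ord //.
  - by move=> a; exact: measurable_cylinder.
  - exact: trivIset_cylinder.
  - by rewrite -cylinder_split; exact: measurable_cylinder.
have [r muE] : exists r, mu (cylinder n.+1 0) = r%:E.
  exists (fine (mu (cylinder n.+1 0))).
  by rewrite fineK // fin_num_measure //; exact: measurable_cylinder.
move: sumE; rewrite IH measure_cylinder0 muE.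
rewrite (eq_bigr (fun=> r%:E)) => [|a _]; last by rewrite measure_cylinder0.
rewrite sumEFin sumr_const card_crd // => -[rE].
congr (_%:E); rewrite vilenkin_MS natrM invfM rE -[r *+ _]mulr_natr mulfK //.
exact: mR_neq0.
Qed.

Lemma integral_cylinder_level N n (g : V -> R) x : (n <= N)%N -> level N g ->
  (forall x, 0 <= g x) ->
  (\int[mu]_(y in cylinder n x) (g y)%:E)%E =
  ((MR n)^-1 * avg (iota n (N - n)) g x)%:E.
Proof.
move=> nN gN g0; rewrite -(subnKC nN) in gN *; rewrite addKn.
move: (N - n)%N gN => d {N nN}; elim: d n x => [|d IH] n x gN.
  rewrite (eq_integral (fun=> (g x)%:E)) => [|y /[!inE] yx].
    rewrite integral_cst; last exact: measurable_cylinder.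
    by rewrite [X in (_ * X)%E]measure_cylinder -EFinM mulrC.
  by rewrite (gN y x) // addn0.
rewrite cylinder_split ge0_integral_bigsetU //=.
- under eq_bigr do rewrite IH ?addSnnS //.
  rewrite sumEFin /coord_avg vilenkin_MS natrM invfM -mulr_sumr mulrA.
  by [].
- by move=> a; exact: measurable_cylinder.
- exact: index_enum_uniq.
- exact: trivIset_cylinder.
- exact: measurable_fun_level (level_comp EFin gN).
- by move=> y _; rewrite lee_fin.
Qed.

Lemma integral_level_ge0 N (g : V -> R) : level N g -> (forall x, 0 <= g x) ->
  (\int[mu]_x (g x)%:E)%E = (mean N g)%:E.
Proof.
move=> gN g0; have := integral_cylinder_level 0 (leq0n N) gN g0.
rewrite subn0 vilenkin_M0 invr1 mul1r => <-; congr (integral _ _ _).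
by apply/seteqP; split => // y _ k.
Qed.

Lemma Rintegral_level N (g : V -> R) : level N g -> \int[mu]_x g x = mean N g.
Proof.
move=> gN; rewrite /Rintegral integralE.
pose gp x := Num.max (g x) 0; pose gm x := Num.max (- g x) 0.
have gpN : level N gp := level_comp (fun t => Num.max t 0) gN.
have gmN : level N gm := level_comp (fun t => Num.max (- t) 0) gN.
rewrite (eq_integral (fun x => (gp x)%:E)) => [|x _]; last by rewrite funeposE -EFin_max.
rewrite [X in (_ - X)%E](eq_integral (fun x => (gm x)%:E)) => [|x _]; last first.
  by rewrite funenegE -EFinN -EFin_max.
rewrite !(@integral_level_ge0 N) //; last 2 first.
- by move=> x; rewrite /gp le_max lexx orbT.
- by move=> x; rewrite /gm le_max lexx orbT.
rewrite -EFinB /= /mean -[LHS](congr1 (@^~ 0) (avgB _ _ _)).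
congr (avg _ _ _); apply/funext => x; rewrite /gp /gm.
by case: (lerP (g x) 0) => gx; case: (lerP (- g x) 0) => gx'; lra.
Qed.

End haar_measure.

(** * Partial sums and the means [T_n] as convolutions *)

Section fourier.
Variables (R : realType) (m : nat -> nat).
Hypothesis m_ge2 : forall k, (2 <= m k)%N.
Variable mu : probability (vilenkin m) R.
Hypothesis mu_haar : normalized_haar mu.
Local Notation V := (vilenkin m).
Local Notation M := (@vilenkin_M m).
Local Notation MR n := ((@vilenkin_M m n)%:R : R).
Local Notation C := R[i].
Local Notation normc := (@Normc.normc R).
Local Notation psi := (@vilenkin_psi R m).
Local Notation dirichlet := (@dirichlet R m).
Implicit Types (x y : V) (n k K N l : nat).

Lemma Re_sum (I : Type) (r : seq I) (P : pred I) (F : I -> C) :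
  complex.Re (\sum_(i <- r | P i) F i) = \sum_(i <- r | P i) complex.Re (F i).
Proof. by elim/big_rec2 : _ => // i y z _ <-; case: (F i) z => a b []. Qed.

Lemma Im_sum (I : Type) (r : seq I) (P : pred I) (F : I -> C) :
  complex.Im (\sum_(i <- r | P i) F i) = \sum_(i <- r | P i) complex.Im (F i).
Proof. by elim/big_rec2 : _ => // i y z _ <-; case: (F i) z => a b []. Qed.

Lemma Re_scale (a : R) (z : C) : complex.Re (a%:C%C * z) = a * complex.Re z.
Proof. by case: z => b c /=; rewrite mul0r subr0. Qed.

Lemma Im_scale (a : R) (z : C) : complex.Im (a%:C%C * z) = a * complex.Im z.
Proof. by case: z => b c /=; rewrite mul0r addr0. Qed.

Lemma natC n : n%:R = (n%:R : R)%:C%C :> C.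
Proof. by rewrite rmorph_nat. Qed.

Lemma Re_avg (s : seq nat) (g : V -> C) x :
  complex.Re (avg s g x) = avg s (fun y => complex.Re (g y)) x.
Proof.
elim: s x => //= k s IH x; rewrite /coord_avg natC -fmorphV Re_scale Re_sum.
by congr (_ * _); apply: eq_bigr.
Qed.

Lemma Im_avg (s : seq nat) (g : V -> C) x :
  complex.Im (avg s g x) = avg s (fun y => complex.Im (g y)) x.
Proof.
elim: s x => //= k s IH x; rewrite /coord_avg natC -fmorphV Im_scale Im_sum.
by congr (_ * _); apply: eq_bigr.
Qed.

Lemma avg_realC (s : seq nat) (g : V -> R) x :
  avg s (fun y => (g y)%:C%C) x = (avg s g x)%:C%C.
Proof.
apply/eqP; rewrite eq_complex Re_avg Im_avg /= avg_cst //.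
by rewrite !eqxx.
Qed.

Lemma cintegral_level N (g : V -> C) : level N g -> cintegral mu g = mean N g.
Proof.
move=> gN; rewrite /cintegral.
rewrite (Rintegral_level m_ge2 mu_haar (level_comp (@complex.Re R) gN)).
rewrite (Rintegral_level m_ge2 mu_haar (level_comp (@complex.Im R) gN)).
by rewrite /mean -Re_avg -Im_avg; case: (avg _ _ _).
Qed.

Lemma fourier_coef_level N (g : V -> C) k : level N g -> (k < M N)%N ->
  fourier_coef mu g k = mean N (fun t => g t * (psi k t)^*%C).
Proof.
move=> gN kM; rewrite /fourier_coef (@cintegral_level N) //.
by apply: level_comp2 => //; apply: (level_comp (@conjc R)); exact: vilenkin_psi_level.
Qed.

Lemma partial_sum_level N (g : V -> C) n x : level N g -> (n <= M N)%N ->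
  partial_sum (fourier_coef mu g) n x = mean N (fun t => g t * dirichlet n (x - t)).
Proof.
move=> gN nM; rewrite /partial_sum /dirichlet.
have -> : mean N (fun t => g t * \sum_(k < n) psi k (x - t)) =
    mean N (fun t => \sum_(k < n) (g t * (psi k t)^*%C) * psi k x).
  congr (mean N _); apply/funext => t; rewrite mulr_sumr; apply: eq_bigr => k _.
  by rewrite vilenkin_psiB // -mulrA [psi k x * _]mulrC.
rewrite /mean avg_sum; apply: eq_bigr => k _.
by rewrite avgMr (@fourier_coef_level N) // (leq_trans (ltn_ord k)).
Qed.

Lemma spike_sub n x y : spike n n (x - y) -> agree n x y.
Proof.
rewrite spikeE => /forallP h k kn; have := h (Ordinal kn); rewrite /= ltn_eqF //=.
by rewrite crdD crdN subr_eq0 => /eqP.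
Qed.

(** The Dirichlet kernel of order [M n] forces [t] to share the first [n] coordinates of [x], so the
    averaged function can be evaluated at [x]; the kernel itself has mean one. *)
Lemma partial_sum_M n N (g : V -> C) : level N g -> (n <= N)%N ->
  partial_sum (fourier_coef mu g) (M n) = avg (iota n (N - n)) g.
Proof.
move=> gN nN; apply/funext => x.
rewrite (partial_sum_level _ gN) ?leq_vilenkin_M //.
have dE t : dirichlet (M n) (x - t) = (MR n * spikeR R n n (x - t))%:C%C.
  by rewrite dirichlet_M.
under eq_fun do rewrite dE.
rewrite (mean_split _ nN) (avgM_level (n := n)) //; last first.
  move=> y z yz; congr (_ * _)%:C%C.
  by apply: (level_reflect x (@spikeR_level R m n n)).
set h := avg _ g; have hn : level n h by apply: avg_iota_level; rewrite subnKC.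
have -> : (fun t => h t * (MR n * spikeR R n n (x - t))%:C%C) =
    (fun t => h x * ((MR n * spikeR R n n (x - t))%:C%C)).
  apply/funext => t; have [st|st] := boolP (spike n n (x - t)).
    by rewrite (hn x t) //; exact: spike_sub.
  by rewrite /spikeR (negPf st) mulr0 !mulr0.
rewrite /mean avgMl avg_realC avgMl.
rewrite -/(mean n _) (mean_reflect x (@spikeR_level R m n n)).
have := @avg_majorant_spike R m m_ge2 0 n 0; rewrite !add0n -/(mean n _) mulrC => ->.
by rewrite vilenkin_M0 /spikeR /= mulr1 rmorph1 mulr1.
Qed.

Variable f : nat -> V -> C.
Hypothesis f_mart : martingale mu f.

(** [f n] is its own partial sum of order [M n], a combination of characters of level [n]; this
    gives invariance at every point. *)
Lemma martingale_level n : level n (f n).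
Proof.
rewrite -(martingale_proj f_mart (leqnn n)) => x y xy; rewrite /partial_sum.
apply: eq_bigr => k _; congr (_ * _).
exact: (@vilenkin_psi_level R m m_ge2 n k (ltn_ord k) x y xy).
Qed.

Lemma martingale_coord_avg n : coord_avg n (f n.+1) = f n.
Proof.
rewrite -(martingale_proj f_mart (leqnSn n)).
by rewrite (partial_sum_M (@martingale_level n.+1)) // subSnn.
Qed.

Lemma fourier_coef_stable N l k : (N <= l)%N -> (k < M N)%N ->
  fourier_coef mu (f l) k = fourier_coef mu (f N) k.
Proof.
move=> Nl kM.
have kl : (k < M l)%N by apply: leq_trans kM _; exact: leq_vilenkin_M.
rewrite (fourier_coef_level (@martingale_level l)) //.
rewrite (fourier_coef_level (@martingale_level N)) // (mean_split _ Nl).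
rewrite (avgM_level (n := N)) //; last first.
  by apply: (level_comp (@conjc R)); exact: vilenkin_psi_level.
by rewrite (avg_martingale martingale_coord_avg).
Qed.

(** The limit is that of a sequence constant from [N] on. *)
Lemma mfourier_coefE N k : (k < M N)%N ->
  mfourier_coef mu f k = fourier_coef mu (f N) k.
Proof.
move=> kM; apply: (@lim_near_cst (R[i]^o : ptopologicalType)).
  exact: norm_hausdorff.
by near=> l; apply: fourier_coef_stable => //; near: l; exact: nbhs_infty_ge.
Unshelve. all: by end_near. Qed.

Variable q : nat -> R.

Definition T_kernel n x : C := ((weight_sum q n)^-1)%:C%C * weighted_kernel q n x.

Lemma T_meanE N n x : (n <= M N)%N ->
  T_mean mu q n f x = convol T_kernel N n (f N) x.
Proof.
move=> nM; rewrite /T_mean /convol /T_kernel /weighted_kernel.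
have -> : (fun t => f N t * (((weight_sum q n)^-1)%:C%C *
      \sum_(k < n) (q k)%:C%C * dirichlet k (x - t))) =
    fun t => ((weight_sum q n)^-1)%:C%C *
      \sum_(k < n) (q k)%:C%C * (f N t * dirichlet k (x - t)).
  apply/funext => t; rewrite mulrCA; congr (_ * _); rewrite mulr_sumr.
  by apply: eq_bigr => k _; rewrite mulrCA.
rewrite /mean avgMl avg_sum; congr (_ * _); apply: eq_bigr => k _.
rewrite avgMl; congr (_ * _).
have kM : (k <= M N)%N by apply: leq_trans nM; exact: ltnW.
rewrite -/(mean N _) -(partial_sum_level _ (@martingale_level N)) //.
rewrite /mpartial_sum /partial_sum; apply: eq_bigr => j _.
by rewrite (@mfourier_coefE N) // (leq_trans (ltn_ord j)).
Qed.

Lemma T_kernel_level K n : (n <= M K)%N -> level K (T_kernel n).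
Proof.
move=> nM; apply: (level_comp (fun z => ((weight_sum q n)^-1)%:C%C * z)).
apply: level_sum => k _; apply: (level_comp (fun z => (q k)%:C%C * z)).
apply: level_sum => j _; apply: vilenkin_psi_level => //.
by rewrite (ltn_trans (ltn_ord j)) // (leq_trans (ltn_ord k)).
Qed.

Hypothesis q_ge0 : forall k, 0 <= q k.
Hypothesis q_nondecreasing : forall i j, (i <= j)%N -> q i <= q j.
Hypothesis q0_gt0 : 0 < q 0%N.

Lemma weight_sum_ge n : (0 < n)%N -> q 0 <= weight_sum q n.
Proof.
case: n => // n _; rewrite /weight_sum big_ord_recl lerDl.
exact: sumr_ge0.
Qed.

Lemma weight_sum_bigO :
  (fun n => q n.-1 / weight_sum q n : R^o) =O_\oo (fun n => n%:R^-1 : R^o) ->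
  exists2 D : R, 0 <= D & forall n, (0 < n)%N -> q n.-1 / weight_sum q n <= D / n%:R.
Proof.
move=> /eqO_exP[D D0 [n0 _ hD]].
(* The second summand covers the finitely many [n < n0]: there [n <= n0], [q n.-1 <= q n0] and
   [weight_sum q n >= q 0]. *)
exists (D + n0%:R * q n0 / q 0).
  by rewrite addr_ge0 ?(ltW D0) // divr_ge0 ?mulr_ge0 // ltW.
move=> n n_gt0; have nR : 0 < n%:R :> R by rewrite ltr0n.
have Q0 := weight_sum_ge n_gt0; have Q1 := lt_le_trans q0_gt0 Q0.
rewrite mulrDl; have [n0n|nn0] := leqP n0 n.
  have := hD n n0n; rewrite /= !ger0_norm ?divr_ge0 ?invr_ge0 ?(ltW Q1) //.
  by move=> /le_trans; apply; rewrite lerDl !mulr_ge0 ?invr_ge0 // ltW.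
apply: (@le_trans _ _ (n0%:R * q n0 / q 0 / n%:R)); last first.
  by rewrite lerDr divr_ge0 // ltW.
have qn : q n.-1 <= q n0.
  by apply: q_nondecreasing; apply: leq_trans (leq_pred n) (ltnW nn0).
rewrite ler_pdivlMr // mulrAC; apply: ler_pM.
- by rewrite mulr_ge0.
- by rewrite invr_ge0 ltW.
- by rewrite mulrC; apply: ler_pM => //; rewrite ler_nat ltnW.
- by rewrite lef_pV2 ?posrE.
Qed.

Variable B : nat.
Hypothesis m_le : forall k, (m k <= B)%N.

Lemma normc_T_kernel_le D :
  (forall n, (0 < n)%N -> q n.-1 / weight_sum q n <= D / n%:R) ->
  forall l n x, (0 < n <= M l.+1)%N ->
  normc (T_kernel n x) <= 4 * B%:R ^+ 2 * D / n%:R * @majorant R m l x.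
Proof.
move=> hD l [//|n] x /= nM; rewrite /T_kernel Normc.normcM normc_real.
have Q1 := lt_le_trans q0_gt0 (weight_sum_ge (ltn0Sn n)).
rewrite ger0_norm ?invr_ge0 ?(ltW Q1) //.
have := normc_weighted_kernel m_ge2 m_le q_ge0 q_nondecreasing x nM.
have Qi : 0 <= (weight_sum q n.+1)^-1 by rewrite invr_ge0 ltW.
move=> /(ler_wpM2l Qi) /le_trans; apply.
set u := majorant R l x; have u0 : 0 <= u := majorant_ge0 _ _ _.
have -> : (weight_sum q n.+1)^-1 * (2 * q n * (2 * B%:R ^+ 2 * u)) =
  4 * B%:R ^+ 2 * u * (q n / weight_sum q n.+1) by ring.
have -> : 4 * B%:R ^+ 2 * D / n.+1%:R * u = 4 * B%:R ^+ 2 * u * (D / n.+1%:R) by ring.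
rewrite ler_wpM2l ?mulr_ge0 ?exprn_ge0 //.
exact: (hD n.+1).
Qed.

End fourier.

(** * Boundedness *)

Section maximal_operator.
Local Open Scope ereal_scope.

(** Read off from the integral as a supremum over simple functions below, so that suprema such as
    [maximal_op] can be compared before any measurability is established for them. *)
Lemma le_integral_ge0 d (T : measurableType d) (R : realType)
    (mu : {measure set T -> \bar R}) (f g : T -> \bar R) :
  (forall x, 0 <= f x) -> (forall x, f x <= g x) ->
  \int[mu]_x f x <= \int[mu]_x g x.
Proof.
move=> f0 fg; have g0 x : 0 <= g x by apply: le_trans (f0 x) (fg x).
rewrite !ge0_integralTE //; apply: ereal_sup_le => _ /= [h hf <-].
by exists h => // x; apply: le_trans (hf x) (fg x).
Qed.

Lemma le_limn_einf (R : realType) (u : (\bar R)^nat) (a : \bar R) n :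
  (forall k, (n <= k)%N -> a <= u k) -> a <= limn_einf u.
Proof.
move=> au; rewrite limn_einf_lim; apply: lime_ge; first exact: is_cvg_einfs.
near=> k; apply: le_ereal_inf_tmp => _ /= [j /= kj <-]; apply: au.
by apply: leq_trans kj; near: k; exact: nbhs_infty_ge.
Unshelve. all: by end_near. Qed.

Lemma limn_einf_le (R : realType) (u : (\bar R)^nat) (b : \bar R) :
  (forall k, u k <= b) -> limn_einf u <= b.
Proof.
move=> ub; rewrite limn_einf_lim; apply: lime_le; first exact: is_cvg_einfs.
near=> k; apply: le_trans (ub k); apply: ereal_inf_lbound.
by exists k => //=.
Unshelve. all: by end_near. Qed.

Lemma poweR_le (R : realType) (r : R) (x y : \bar R) :
  (0 <= r)%R -> 0 <= x -> x <= y -> x `^ r <= y `^ r.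
Proof.
move=> r0 x0 xy; apply: gt0_ler_poweR => //; rewrite in_itv /= leey andbT //.
exact: le_trans xy.
Qed.

End maximal_operator.

(** * From finite ranges of indices to the full maximal operator *)

Section boundedness.
Variables (R : realType) (m : nat -> nat).
Hypothesis m_ge2 : forall k, (2 <= m k)%N.
Variable mu : probability (vilenkin m) R.
Hypothesis mu_haar : normalized_haar mu.
Variable p : R.
Hypothesis p_gt0 : 0 < p.
Local Notation V := (vilenkin m).
Local Notation M := (@vilenkin_M m).
Local Notation C := R[i].
Local Notation normc := (@Normc.normc R).

Variables (f : nat -> V -> C).
Hypothesis f_mart : martingale mu f.

Lemma martingale_max_ge n x : ((normc (f n x))%:E <= martingale_max f x)%E.
Proof. by apply: ereal_sup_ubound; exists n. Qed.

Lemma martingale_max_ge0 x : (0 <= martingale_max f x)%E.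
Proof. by apply: le_trans (martingale_max_ge 0 x); rewrite lee_fin normc_ge0. Qed.

Definition hardy_integral : \bar R := (\int[mu]_x (martingale_max f x) `^ p)%E.

Lemma hardy_normE : hardy_norm mu p f = (hardy_integral `^ p^-1)%E.
Proof.
rewrite /hardy_norm unlock /hardy_integral; congr (_ `^ _)%E.
by apply: eq_integral => x _; rewrite gee0_abs // martingale_max_ge0.
Qed.

Lemma hardy_integral_ge0 : (0 <= hardy_integral)%E.
Proof. by apply: integral_ge0 => x _; exact: poweR_ge0. Qed.

Lemma mean_running_max_le N :
  ((mean N (fun x => running_max f N x `^ p))%:E <= hardy_integral)%E.
Proof.
rewrite -(integral_level_ge0 m_ge2 mu_haar (N := N)); last 2 first.
- apply: (level_comp (fun t => t `^ p)); apply: running_max_level => n.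
  exact: (martingale_level m_ge2 f_mart).
- by move=> x; exact: powR_ge0.
apply: le_integral_ge0 => x; first by rewrite lee_fin powR_ge0.
rewrite -poweR_EFin; apply: poweR_le; first exact: ltW.
  by rewrite lee_fin running_max_ge0.
rewrite /running_max; elim/big_ind : _ => [|a b aM bM|j _].
- exact: martingale_max_ge0.
- by rewrite EFin_max ge_max aM.
- exact: martingale_max_ge.
Qed.

Variables (T : nat -> V -> C) (w : nat -> R) (A : R).
Hypothesis A_ge0 : 0 <= A.
Hypothesis w_gt0 : forall n, (0 < n)%N -> 0 < w n.
Hypothesis T_le : forall N (c : R), 0 < c -> (forall x, normc (f 0 x) <= c) ->
  exists U : V -> R, [/\ level N U, forall x, 0 <= U x,
    forall n x, (0 < n <= M N)%N -> normc (T n x) / w n <= U x &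
    mean N (fun x => U x `^ p) <=
      A * (c `^ p + mean N (fun x => running_max f N x `^ p))].

Definition maximal_op x : \bar R :=
  ereal_sup [set (normc (T n x) / w n)%:E | n in [set n | (0 < n)%N]].

Lemma maximal_op_ge0 x : (0 <= maximal_op x)%E.
Proof.
apply: (@le_trans _ _ (normc (T 1 x) / w 1)%:E).
  by rewrite lee_fin divr_ge0 ?normc_ge0 // ltW // w_gt0.
by apply: ereal_sup_ubound; exists 1%N.
Qed.

Lemma integral_maximal_op_le : (hardy_integral < +oo)%E ->
  (\int[mu]_x maximal_op x `^ p <= (2 * A)%:E * hardy_integral)%E.
Proof.
move=> Ioo; have p0 := ltW p_gt0.
have Ifin : hardy_integral \is a fin_num by rewrite ge0_fin_numE ?hardy_integral_ge0.
set i := fine hardy_integral; have IE : hardy_integral = i%:E by rewrite fineK.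
have i0 : 0 <= i by rewrite fine_ge0 // hardy_integral_ge0.
rewrite IE -EFinM; apply/lee_addgt0Pr => e e0.
(* The slack [e'] keeps [c] positive even when the Hardy integral vanishes; dividing by [A + 1]
   ensures [A * e' <= e]. *)
pose e' := e / (A + 1).
have A1 : 0 < A + 1 by rewrite ltr_wpDl.
have e'0 : 0 < e' by rewrite divr_gt0.
(* Now [c^p] is nearly the Hardy integral, so [c^p] and the running maximum each contribute about
   [A * i]: the origin of [2 * A]. *)
pose c := (i + e') `^ p^-1.
have ie0 : 0 < i + e' by rewrite ltr_wpDl.
have c0 : 0 < c by rewrite powR_gt0.
have cp : c `^ p = i + e' by rewrite -powRrM mulVf ?gt_eqF // powRr1 // ltW.
have run N : mean N (fun x => running_max f N x `^ p) <= i.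
  by rewrite -lee_fin -IE mean_running_max_le.
(* [f 0] is constant, so its [p]-th power is at most the mean of the running maximum at time
   zero. *)
have f0c x : normc (f 0 x) <= c.
  have -> : normc (f 0 x) = (normc (f 0 x) `^ p) `^ p^-1.
    by rewrite -powRrM mulfV ?gt_eqF // powRr1 // normc_ge0.
  have f0l := martingale_level m_ge2 f_mart (n := 0).
  apply: ge0_ler_powR; rewrite ?nnegrE ?powR_ge0 ?invr_ge0 ?(ltW ie0) //.
  apply: (@le_trans _ _ i); last by rewrite lerDl ltW.
  apply: le_trans (run 0); rewrite /mean /avg /=.
  apply: ge0_ler_powR; rewrite ?nnegrE ?running_max_ge0 ?normc_ge0 //.
  by rewrite (level0 f0l x 0); exact: running_max_ge.
have [U hU] := choice (fun N => T_le N c0 f0c).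
have UN N : level N (fun x => (U N x `^ p)%:E).
  by have [lU _ _ _] := hU N; exact: (level_comp (fun t => (t `^ p)%:E) lU).
have U0 N x : (0 <= (U N x `^ p)%:E)%E by rewrite lee_fin powR_ge0.
have intU N : (\int[mu]_x (U N x `^ p)%:E <= (2 * A * i + e)%:E)%E.
  have [lU _ _ mU] := hU N.
  rewrite (integral_level_ge0 m_ge2 mu_haar (level_comp (fun t => t `^ p) lU)); last first.
    by move=> x; exact: powR_ge0.
  rewrite lee_fin; apply: (le_trans mU); rewrite cp.
  apply: (@le_trans _ _ (A * (i + e' + i))); first by rewrite ler_wpM2l // lerD2l.
  have : A * e' <= e.
    by rewrite mulrCA -[leRHS]mulr1 ler_wpM2l // ?ler_pdivrMr ?mul1r ?lerDl // ltW.
  lra.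
(* A fixed [n] satisfies [n <= M N] for all [N >= n], so [U N x] dominates its term from then on and
   the lower limit does too. *)
have le_sup x : (maximal_op x `^ p <= limn_einf (fun N => (U N x `^ p)%:E))%E.
  set G := limn_einf _.
  have G0 : (0 <= G)%E by apply: (@le_limn_einf _ _ _ 0) => k _; exact: U0.
  have -> : G = ((G `^ p^-1) `^ p)%E.
    by rewrite -poweRrM mulVf ?gt_eqF // poweRe1.
  apply: poweR_le => //; first exact: maximal_op_ge0.
  apply: ge_ereal_sup => _ [n /= n0 <-].
  have t0 : 0 <= normc (T n x) / w n by rewrite divr_ge0 ?normc_ge0 // ltW // w_gt0.
  rewrite -[leLHS]poweRe1 ?lee_fin // -(mulfV (lt0r_neq0 p_gt0)) poweRrM.
  apply: poweR_le; rewrite ?invr_ge0 ?poweR_ge0 //.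
  apply: (@le_limn_einf _ _ _ n) => N nN; rewrite poweR_EFin lee_fin.
  have [_ Ux hx _] := hU N.
  apply: ge0_ler_powR; rewrite ?nnegrE //.
  by apply: hx; rewrite n0 (leq_trans nN) // ltnW // ltn_vilenkin_M.
apply: (@le_trans _ _ (\int[mu]_x limn_einf (fun N => (U N x `^ p)%:E))%E).
  by apply: le_integral_ge0 => // x; exact: poweR_ge0.
apply: (le_trans (fatou mu measurableT _ _)) => [N|N x _|].
- exact: measurable_fun_level (UN N).
- exact: U0.
- exact: limn_einf_le.
Qed.

End boundedness.

Theorem mainTheorem13 (R : realType) (m : nat -> nat)
  (m_ge2 : forall k, (2 <= m k)%N)
  (m_bounded : exists B : nat, forall k, (m k <= B)%N)
  (mu : probability (vilenkin m) R) (mu_haar : normalized_haar mu)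
  (p : R) (p_gt0 : 0 < p) (p_le : p <= 2^-1)
  (q : nat -> R)
  (q_ge0 : forall k, 0 <= q k)
  (q_nondecreasing : forall i j, (i <= j)%N -> q i <= q j)
  (q0_gt0 : 0 < q 0%N)
  (q_bigO : (fun n => q n.-1 / weight_sum q n : R^o) =O_\oo
            (fun n => n%:R^-1 : R^o)) :
  bounded_hardy_Lp mu p (T_max mu q p).
Proof.
have [B m_le] := m_bounded.
have p01 : 0 < p <= 1 by rewrite p_gt0 (le_trans p_le) // invf_le1 ?ler1n.
have [D D0 hD] := weight_sum_bigO q_ge0 q_nondecreasing q0_gt0 q_bigO.
have [Cw _ hCw] := weighted_mean_majorant p_gt0 p_le m_ge2 m_le.
have ker_le := normc_T_kernel_le m_ge2 q_ge0 q_nondecreasing q0_gt0 m_le hD.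
have Cker0 : 0 <= 4 * B%:R ^+ 2 * D by rewrite !mulr_ge0 ?exprn_ge0.
have [A A0 hA] := finite_maximal_inequality m_ge2 Cker0 (@T_kernel_level R m m_ge2 q)
  ker_le p01 (@weight_gt0 R p) (@weight_le R p p_gt0 p_le) hCw m_le.
(* [A] was obtained before the martingale is introduced, so the constant is uniform; the root undoes
   the [p]-th power in both norms. *)
exists ((2 * A) `^ p^-1) => f [f_mart f_fin].
have fl := @martingale_level R m m_ge2 mu f f_mart.
have fm := @martingale_coord_avg R m m_ge2 mu mu_haar f f_mart.
have Ioo : (hardy_integral mu p f < +oo)%E.
  apply: (@lty_poweRy _ _ p^-1); first by rewrite invr_neq0 // gt_eqF.
  by rewrite -hardy_normE.
have T_le N (c : R) : 0 < c -> (forall x, Normc.normc (f 0 x) <= c) ->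
  exists U : vilenkin m -> R, [/\ level N U, forall x, 0 <= U x,
    forall n x, (0 < n <= @vilenkin_M m N)%N ->
      Normc.normc (T_mean mu q n f x) / weight p n <= U x &
    mean N (fun x => U x `^ p) <=
      A * (c `^ p + mean N (fun x => running_max f N x `^ p))].
  move=> c0 f0c; have [U [lU U0 UT mU]] := hA f N c fl fm c0 f0c.
  exists U; split => // n x nN; have /andP[_ nM] := nN.
  by rewrite (@T_meanE R m m_ge2 mu mu_haar f f_mart q N n x nM); exact: UT.
have main := integral_maximal_op_le m_ge2 mu_haar p_gt0 f_mart A0
  (@weight_gt0 R p) T_le Ioo.
rewrite hardy_normE unlock.
rewrite (eq_integral (fun x => maximal_op (fun n => T_mean mu q n f) (weight p) x `^ p)%E).
  rewrite -poweR_EFin -poweRM ?lee_fin ?mulr_ge0 ?hardy_integral_ge0 //.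
  apply: poweR_le => //; first by rewrite invr_ge0 ltW.
  by apply: integral_ge0 => x _; exact: poweR_ge0.
move=> x _; rewrite gee0_abs //.
exact: (@maximal_op_ge0 R m (fun n => T_mean mu q n f) (weight p) (@weight_gt0 R p) x).
Qed.
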